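(* Let $D$ be an integral domain, $\star$ a semistar operation on $D$, and $n$ a positive integer. The following are equivalent: (1) $\widetilde{\star}\text{-}\dim_v(D)=n$; (2) $\star[n]\text{-}\dim(D[n])=2n$; (3) $\star[r]\text{-}\dim(D[r])=r+n$ for every integer $r\ge n-1$ (with the conventions $D[0]=D$ and $\star[0]=\widetilde\star$); (4) every $(\star,d_T)$-linked overring $T$ of $D$ has Krull dimension at most $n$, and $n$ is the least integer with this property.
   Context: $D$ is an integral domain with quotient field $K$; $f(D)$ denotes nonzero finitely generated fractional ideals, $\overline{\mathcal F}(D)$ nonzero $D$-submodules of $K$. A semistar operation $\star$ on $D$ is a map $\overline{\mathcal F}(D)\to\overline{\mathcal F}(D)$ with $(xE)^\star=xE^\star$ ($0\neq x\in K$), $E\subseteq F\Rightarrow E^\star\subseteq F^\star$, $E\subseteq E^\star=(E^\star)^\star$. $E^{\star_f}:=\bigcup\{F^\star:F\in f(D),F\subseteq E\}$. A nonzero ideal $I$ is a quasi-$\star$-ideal if $I^\star\cap D=I$; quasi-$\star$-primes/quasi-$\star$-maximal ideals are the prime ones / maximal proper ones; sets $\operatorname{QSpec}^\star(D)$, $\operatorname{QMax}^\star(D)$. $E^{\widetilde\star}:=\bigcap\{ED_M:M\in\operatorname{QMax}^{\star_f}(D)\}$ ($=K$ if empty). $\star$-$\operatorname{ht}(P)$: supremum of lengths of chains of quasi-$\star$-primes from $(0)$ to $P$; $\star$-$\dim(D):=\sup\{\star$-$\operatorname{ht}(P):P\in\operatorname{QSpec}^\star(D)\}$ ($0$ if none).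 Polynomial extension: with $\Theta^\star_1:=\{Q\in\operatorname{Spec}(D[X]): Q\cap D=0\text{ or }(Q\cap D)^{\star_f}\subsetneq D^\star\}$ and $\mathfrak S:=D[X][Y]\setminus\bigcup\{Q[Y]:Q\in\Theta^\star_1\}$, $E^{\star[X]}:=E[Y]_{\mathfrak S}\cap K(X)$; this is a semistar operation on $D[X]$ with $\operatorname{QSpec}^{\star[X]}(D[X])=\Theta^\star_1\setminus\{0\}$. $\star[n]:=(\star[n-1])[X_n]$ on $D[n]=D[X_1,\dots,X_n]$. A valuation overring $V$ of $D$ is a $\widetilde\star$-valuation overring if $F^{\widetilde\star}\subseteq FV$ for all $F\in f(D)$; $\widetilde\star$-$\dim_v(D):=\sup\{\dim V\}$ over $\widetilde\star$-valuation overrings. An overring $T$ of $D$ ($D\subseteq T\subseteq K$) is $(\star,d_T)$-linked to $D$ if for every nonzero finitely generated ideal $F$ of $D$ with $F^\star=D^\star$ one has $FT=T$. *)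

(* Defs.v *)
From HB Require Import structures.
From mathcomp Require Import all_boot all_order all_algebra.
From mathcomp Require Import fraction.
Set Implicit Arguments. Unset Strict Implicit. Unset Printing Implicit Defensive.
Import GRing.Theory.
Local Open Scope ring_scope.

(* An integral domain D is represented as a subring of a field K which is its
   quotient field; subsets of K are predicates K -> Prop. *)
Section Defs.
Variable K : fieldType.
Implicit Types (D E F I P T V : K -> Prop).

Definition subset E F := forall x, E x -> F x.
Definition seteq E F := subset E F /\ subset F E.
Definition psubset E F := subset E F /\ exists x, F x /\ ~ E x.

Definition subring D :=
  D 0 /\ D 1 /\ (forall x y, D x -> D y -> D (x - y)) /\
  (forall x y, D x -> D y -> D (x * y)).

Definition quotient_field_of D :=
  forall x, exists a b, D a /\ D b /\ b != 0 /\ x = a / b.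

Definition submod D E :=
  E 0 /\ (forall x y, E x -> E y -> E (x + y)) /\
  (forall d x, D d -> E x -> E (d * x)).
Definition Fbar D E := submod D E /\ exists x, E x /\ x != 0.

Definition scale (x : K) E := fun y => exists e, E e /\ y = x * e.

Definition semistar D (star : (K -> Prop) -> (K -> Prop)) :=
  (forall E, Fbar D E -> Fbar D (star E)) /\
  (forall x E, x != 0 -> Fbar D E -> seteq (star (scale x E)) (scale x (star E))) /\
  (forall E F, Fbar D E -> Fbar D F -> subset E F -> subset (star E) (star F)) /\
  (forall E, Fbar D E -> subset E (star E)) /\
  (forall E, Fbar D E -> seteq (star (star E)) (star E)).

Definition fgen (R : K -> Prop) (s : seq K) : K -> Prop := fun y =>
  exists c : seq K, size c = size s /\ (forall i, (i < size s)%N -> R c`_i) /\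
    y = \sum_(i < size s) c`_i * s`_i.
Definition fgnz (s : seq K) := exists x, x \in s /\ x != 0.

Definition star_f D (star : (K -> Prop) -> (K -> Prop)) E : K -> Prop := fun y =>
  exists s, fgnz s /\ subset (fgen D s) E /\ star (fgen D s) y.

Definition ideal D I := subset I D /\ submod D I.
Definition prime D P :=
  ideal D P /\ ~ P 1 /\ forall a b, D a -> D b -> P (a * b) -> P a \/ P b.

Definition quasi_ideal D star I :=
  ideal D I /\ (exists x, I x /\ x != 0) /\ seteq (fun y => star I y /\ D y) I.
Definition qprime D star P := quasi_ideal D star P /\ prime D P.
Definition qmax D star M :=
  quasi_ideal D star M /\ ~ M 1 /\
  forall I, quasi_ideal D star I -> ~ I 1 -> subset M I -> subset I M.

(* \widetilde{star}: E^~ = intersection of E D_M over quasi-star_f-maximal M *)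
Definition tilde D star E : K -> Prop := fun y =>
  forall M, qmax D (star_f D star) M ->
    exists e s, E e /\ D s /\ ~ M s /\ y * s = e.

Definition bot : K -> Prop := fun _ => False.

(* chain of quasi-star-primes (0) < P_1 < ... < P_k, of length k *)
Definition star_chain D star (k : nat) :=
  exists Ps : seq (K -> Prop), size Ps = k /\
    (forall i, (i < k)%N -> qprime D star (nth bot Ps i)) /\
    (forall i, (i.+1 < k)%N -> psubset (nth bot Ps i) (nth bot Ps i.+1)).
Definition star_dim_eq D star (n : nat) :=
  star_chain D star n /\ ~ star_chain D star n.+1.

Definition krull_chain T (k : nat) :=
  exists Ps : seq (K -> Prop), size Ps = k.+1 /\
    (forall i, (i < k.+1)%N -> prime T (nth bot Ps i)) /\
    (forall i, (i.+1 < k.+1)%N -> psubset (nth bot Ps i) (nth bot Ps i.+1)).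
Definition krull_dim_le T (n : nat) := ~ krull_chain T n.+1.

Definition overring D T := subring T /\ subset D T.
Definition valuation_overring D V :=
  overring D V /\ forall x, x != 0 -> V x \/ V x^-1.
Definition tilde_val D star V :=
  valuation_overring D V /\
  forall s, fgnz s -> subset (tilde D star (fgen D s)) (fgen V s).
Definition tilde_dimv_eq D star (n : nat) :=
  (exists V, tilde_val D star V /\ krull_chain V n) /\
  (forall V, tilde_val D star V -> krull_dim_le V n).

Definition linked D star T :=
  overring D T /\
  forall s, fgnz s -> (forall i, (i < size s)%N -> D s`_i) ->
    seteq (star (fgen D s)) (star D) -> seteq (fgen T s) T.
End Defs.

Unset Implicit Arguments.
Record setting := Setting {
  sfld : fieldType;
  sdom : sfld -> Prop;
  sop : (sfld -> Prop) -> (sfld -> Prop) }.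
Set Implicit Arguments.

Section PolyExt.
Variable K : fieldType.
Variable D : K -> Prop.
Variable star : (K -> Prop) -> (K -> Prop).
Local Notation KX := {fraction {poly K}}.
Local Notation tf := (@tofrac {poly K}).

Definition polyD : KX -> Prop := fun z =>
  exists p : {poly K}, (forall i, D p`_i) /\ z = tf p.

Definition Theta (Q : KX -> Prop) :=
  prime polyD Q /\
  ((forall a, D a -> Q (tf a%:P) -> a = 0) \/
   psubset (star_f D star (fun a => D a /\ Q (tf a%:P))) (star D)).

Definition Sset (g : {poly KX}) :=
  (forall i, polyD g`_i) /\ forall Q, Theta Q -> ~ (forall i, Q g`_i).

(* E^{star[X]} = E[Y]_S \cap K(X) *)
Definition starX (E : KX -> Prop) : KX -> Prop := fun f =>
  exists g, Sset g /\ forall i, E (f * g`_i).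
End PolyExt.

Definition polyext (s : setting) : setting :=
  @Setting {fraction {poly sfld s}} (@polyD (sfld s) (sdom s))
    (@starX (sfld s) (sdom s) (sop s)).

Fixpoint ext (r : nat) (s : setting) : setting :=
  match r with 0 => s | r'.+1 => polyext (ext r' s) end.

Definition starn (K : fieldType) (D : K -> Prop) star (r : nat) : setting :=
  match r with
  | 0 => @Setting K D (tilde D star)
  | _ => ext r (@Setting K D star)
  end.

Definition setting_dim_eq (s : setting) (k : nat) :=
  star_dim_eq (sdom s) (sop s) k.

(* Main.v *)
(* Call a prime P of D admissible if P = 0 or 1 does not lie in P^(star_f).
   The star~-valuation overrings are the valuation overrings with admissible
   centre, the linked overrings are those all of whose primes contract to
   admissible primes, and the quasi-star[r]-primes of D[r] are the nonzero
   primes contracting to admissible primes.  A valuation ring can be found over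
   any chain of primes, so linked overrings and star~-valuation overrings have
   the same dimensions.  It remains to compare chains in D[r] with chains in
   valuation overrings V:
   - a chain in D[r] lifts to a valuation ring W of K(X_1,...,X_r), and
     restricting W to the coefficient field loses at most one prime per variable,
     because the transcendence degree drops by one;
   - a chain of length n in V may collapse on D, but its first step does not;
     pulling primes of T back along f |-> f(y) from T[X] to T, together with
     (0), lengthens the chain by one and makes one more step visible in D[X],
     so after n - 1 variables nothing collapses. *)

Require Import Defs.
From HB Require Import structures.
From mathcomp Require Import all_boot all_order all_algebra.
From mathcomp Require Import fraction ring zify boolp.
From mathcomp Require classical_sets.
Require Import Defs.
Set Implicit Arguments. Unset Strict Implicit. Unset Printing Implicit Defensive.
Import GRing.Theory.
Local Open Scope ring_scope.

(** * Subrings, submodules and primes inside a field *)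

Section Subrings.
Variable K : fieldType.
Implicit Types (R T V W P Q I : K -> Prop).

Lemma subring0 R : subring R -> R 0. Proof. by case. Qed.
Lemma subring1 R : subring R -> R 1. Proof. by case=> _ []. Qed.
Lemma subringB R x y : subring R -> R x -> R y -> R (x - y).
Proof. by case=> _ [_ [h _]]; exact: h. Qed.
Lemma subringM R x y : subring R -> R x -> R y -> R (x * y).
Proof. by case=> _ [_ [_ h]]; exact: h. Qed.
Lemma subringN R x : subring R -> R x -> R (- x).
Proof. by move=> hR hx; rewrite -sub0r; apply: subringB => //; exact: subring0. Qed.
Lemma subringD R x y : subring R -> R x -> R y -> R (x + y).
Proof. by move=> hR hx hy; rewrite -[y]opprK; apply: subringB => //; exact: subringN. Qed.
Lemma subringX R x n : subring R -> R x -> R (x ^+ n).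
Proof.
move=> hR hx; elim: n => [|n IH]; first by rewrite expr0; exact: subring1.
by rewrite exprS; exact: subringM.
Qed.

Lemma submod0 R I : submod R I -> I 0. Proof. by case. Qed.
Lemma submodD R I x y : submod R I -> I x -> I y -> I (x + y).
Proof. by case=> _ [h _]; exact: h. Qed.
Lemma submodM R I d x : submod R I -> R d -> I x -> I (d * x).
Proof. by case=> _ [_ h]; exact: h. Qed.
Lemma submod_sum R I (J : Type) (r : seq J) (F : J -> K) (p : pred J) :
  submod R I -> (forall i, p i -> I (F i)) -> I (\sum_(i <- r | p i) F i).
Proof. by case=> h0 [hD _] hF; elim/big_ind: _. Qed.

Lemma subring_submod R : subring R -> submod R R.
Proof.
move=> hR; split; first exact: subring0.
by split=> x y; [exact: subringD | exact: subringM].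
Qed.

Lemma prime_submod R P : prime R P -> submod R P. Proof. by case=> [[]]. Qed.
Lemma prime_sub R P : prime R P -> subset P R. Proof. by case=> [[]]. Qed.
Lemma prime0 R P : prime R P -> P 0.
Proof. by move/prime_submod/submod0. Qed.
Lemma prime_n1 R P : prime R P -> ~ P 1. Proof. by case=> _ []. Qed.
Lemma prime_or R P a b : prime R P -> R a -> R b -> P (a * b) -> P a \/ P b.
Proof. by case=> _ [_ h]; exact: h. Qed.
Lemma prime_ml R P d x : prime R P -> R d -> P x -> P (d * x).
Proof. by move/prime_submod/submodM; apply. Qed.
Lemma prime_mr R P d x : prime R P -> R d -> P x -> P (x * d).
Proof. by rewrite mulrC; exact: prime_ml. Qed.
Lemma prime_D R P x y : prime R P -> P x -> P y -> P (x + y).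
Proof. by move/prime_submod/submodD; apply. Qed.
Lemma prime_N R P x : subring R -> prime R P -> P x -> P (- x).
Proof.
move=> hR hP hx; rewrite -mulN1r; apply: (prime_ml hP) => //.
by apply: subringN => //; exact: subring1.
Qed.
Lemma prime_X R P x n : subring R -> prime R P -> R x -> P (x ^+ n) -> P x.
Proof.
move=> hR hP hx; elim: n => [|n IH]; first by rewrite expr0 => /(prime_n1 hP).
by rewrite exprS => /(prime_or hP hx (subringX n hR hx)) [|/IH].
Qed.
Lemma prime_Xn R P x n : subring R -> prime R P -> P x -> P (x ^+ n.+1).
Proof.
move=> hR hP hx; rewrite exprSr; apply: (prime_ml hP) => //.
by apply: subringX => //; exact: prime_sub hx.
Qed.

Lemma prime_zero R : subring R -> prime R (fun x => x = 0).
Proof.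
move=> hR; split; last first.
  split; first by move/eqP; rewrite oner_eq0.
  by move=> a b _ _ /eqP; rewrite mulf_eq0 => /orP [] /eqP; [left | right].
split; first by move=> x ->; exact: subring0.
by split=> //; split=> [x y -> ->|d x _ ->]; rewrite (addr0, mulr0).
Qed.

Lemma prime_contr R T P : subring R -> subset R T -> prime T P ->
  prime R (fun x => R x /\ P x).
Proof.
move=> hR sRT hP; split.
  split=> [x []//|]; split; first by split; [exact: subring0 | exact: prime0 hP].
  split=> [x y [hx px] [hy py]|d x hd [hx px]].
    by split; [exact: subringD | exact: prime_D hP _ _].
  by split; [exact: subringM | apply: (prime_ml hP) => //; exact: sRT].
split=> [[_ /(prime_n1 hP)]//|a b ha hb [_ /(prime_or hP (sRT _ ha) (sRT _ hb))]].
by case; [left | right].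
Qed.

(** * Valuation rings and their maximal ideals *)

Definition valring V := subring V /\ forall x, x != 0 -> V x \/ V x^-1.

(* The conclusion [x = 0] absorbs the junk value [0^-1 = 0]. *)
Definition maxid V x := V x /\ (V x^-1 -> x = 0).

(** Of two nonzero elements one divides the other, so their sum is a multiple of one of them;
    elements of [V] outside [maxid V] are units, whence primality. *)
Lemma maxid_prime V : valring V -> prime V (maxid V).
Proof.
move=> [hV vV].
have mM d x : V d -> maxid V x -> maxid V (d * x).
  move=> hd [hx nx]; split; first exact: subringM.
  have [->|d0] := eqVneq d 0; first by rewrite mul0r.
  move=> h; rewrite nx ?mulr0 //.
  have -> : x^-1 = d * (d * x)^-1 by rewrite invfM mulrA divff // mul1r.
  exact: subringM.
split; last first.
  split; first by case=> _; rewrite invr1 => /(_ (subring1 hV)) /eqP; rewrite oner_eq0.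
  move=> a b ha hb [_ nab].
  apply: contrapT => /not_orP [na nb].
  have inv c : V c -> ~ maxid V c -> c != 0 /\ V c^-1.
    move=> hc nc; split.
      by apply/eqP => c0; apply: nc; split.
    by apply: contrapT => nVc; apply: nc; split.
  have [[a0 ia] [b0 ib]] := (inv a ha na, inv b hb nb).
  have /eqP : a * b = 0 by apply: nab; rewrite invfM; exact: subringM.
  by rewrite mulf_eq0 (negPf a0) (negPf b0).
split; first by move=> x [].
split; first by split; first exact: subring0.
split=> // x y mx my.
have [->|x0] := eqVneq x 0; first by rewrite add0r.
have [->|y0] := eqVneq y 0; first by rewrite addr0.
have xy0 : x / y != 0 by rewrite mulf_neq0 ?invr_eq0.
case: (vV _ xy0) => h.
  have -> : x + y = (x / y + 1) * y by rewrite mulrDl mul1r divfK.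
  by apply: mM => //; apply: subringD => //; exact: subring1.
have -> : x + y = (1 + (x / y)^-1) * x by rewrite invf_div mulrDl mul1r divfK.
by apply: mM => //; apply: subringD => //; exact: subring1.
Qed.

Lemma maxid_sub V : subset (maxid V) V. Proof. by move=> x []. Qed.

Lemma maxid_inv V x : V x -> ~ maxid V x -> V x^-1.
Proof. by move=> hx nx; apply: contrapT => nV; apply: nx; split. Qed.

Lemma prime_sub_maxid V P : prime V P -> subset P (maxid V).
Proof.
move=> hP x px; split; first exact: prime_sub hP _ px.
move=> ix; have [//|x0] := eqVneq x 0.
by case: (prime_n1 hP); rewrite -(mulVf x0); exact: prime_ml hP _ _.
Qed.

Lemma submodB R I x y : subring R -> submod R I -> I x -> I y -> I (x - y).
Proof.
move=> hR hI hx hy; apply: (submodD hI) => //.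
rewrite -mulN1r; apply: (submodM hI) => //.
by apply: subringN => //; exact: subring1.
Qed.

(** For an ideal [I] of a subring [R], [adjoin R x] is R[x] and [adjoin I x] is I R[x]. *)
Definition adjoin (E : K -> Prop) (x : K) : K -> Prop :=
  fun z => exists p : {poly K}, (forall i, E p`_i) /\ z = p.[x].

Lemma adjoin_const E x a : E 0 -> E a -> adjoin E x a.
Proof.
move=> h0 ha; exists a%:P; split; last by rewrite hornerC.
by move=> i; rewrite coefC; case: (i == _).
Qed.

Lemma adjoin_subring R x : subring R -> subring (adjoin R x).
Proof.
move=> hR; split; first by apply: adjoin_const; exact: subring0.
split; first by apply: adjoin_const; [exact: subring0 | exact: subring1].
split=> _ _ [p [hp ->]] [q [hq ->]].
  by exists (p - q); split=> [i|]; rewrite ?hornerD ?hornerN // coefB; exact: subringB.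
exists (p * q); split=> [i|]; last by rewrite hornerM.
rewrite coefM; apply: submod_sum; first exact: subring_submod.
by move=> j _; exact: subringM.
Qed.

Lemma adjoin_ideal R I x : subring R -> ideal R I ->
  ideal (adjoin R x) (adjoin I x).
Proof.
move=> hR [sI hI]; split.
  by move=> _ [p [hp ->]]; exists p; split=> // i; apply: sI.
split; first by apply: adjoin_const; exact: submod0 hI.
split=> _ _ [p [hp ->]] [q [hq ->]].
  by exists (p + q); split=> [i|]; rewrite ?hornerD // coefD; exact: submodD hI _ _.
exists (p * q); split=> [i|]; last by rewrite hornerM.
rewrite coefM; apply: (submod_sum _ hI).
by move=> j _; exact: submodM hI _ _.
Qed.

Lemma adjoin_gen R x : subring R -> adjoin R x x.
Proof.
move=> hR; exists 'X; split; last by rewrite hornerX.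
move=> i; rewrite coefX; case: (i == _); [exact: subring1 | exact: subring0].
Qed.

(* The descent behind Chevalley's theorem: if [1] lies in both [I R[x]] and
   [I R[x^-1]], a relation of minimal degree in [x] can be shortened. *)
Lemma adjoin_inv_unit R I x : subring R -> ideal R I -> x != 0 ->
  adjoin I x 1 -> adjoin I x^-1 1 -> I 1.
Proof.
move=> hR [sI hI] x0.
pose short y n := exists p : {poly K}, (forall i, I p`_i) /\ 1 = p.[y] /\ (size p <= n)%N.
(* Induction on a bound for the total size of a relation in [y] and one in its inverse. *)
suff H k : forall y n m, (n + m <= k)%N -> y != 0 -> short y n -> short y^-1 m -> I 1.
  move=> [p [hp ep]] [q [hq eq]].
  by apply: (H _ x (size p) (size q) (leqnn _)) => //; [exists p | exists q].
elim: k => [|k IH] y n m hk y0 Sn Sm.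
  case: Sn => p [hp [ep sp]].
  have p0 : p = 0 by apply/eqP; rewrite -size_poly_eq0; lia.
  by move: (oner_eq0 K); rewrite ep p0 horner0 eqxx.
(* Exchanging [y] with its inverse makes the relation in [y] the longer one. *)
wlog hm : y n m hk y0 Sn Sm / (m <= n)%N.
  move=> W; case: (leqP m n) => h; first exact: (W y n m).
  by apply: (W y^-1 m n); rewrite ?invr_eq0 ?invrK 1?addnC // ltnW.
case: (Sn) (Sm) => p [hp [ep sp]] [q [hq [eq sq]]].
case: n => [|[|n]] in hk hm sp Sn *.
- have p0 : p = 0 by apply/eqP; rewrite -size_poly_eq0; lia.
  by move: (oner_eq0 K); rewrite ep p0 horner0 eqxx.
- by rewrite ep (size1_polyC sp) hornerC.
(* Multiplying the relation in the inverse of [y] by [y ^+ n.+1] clears negative powers; q_0 denotes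
   the constant coefficient of [q]. *)
have eq' : y ^+ n.+1 * (1 - q`_0) = \sum_(j < n.+1) q`_(n.+1 - j) * y ^+ j.
  have sq' : (size q <= n.+2)%N by exact: leq_trans sq hm.
  rewrite {1}eq (horner_coef_wide _ sq') big_ord_recl /= expr0 mulr1 addrAC subrr add0r.
  rewrite big_distrr /= (reindex_inj rev_ord_inj) /=.
  apply: eq_bigr => j _; have hj := ltn_ord j.
  have -> : bump 0 (n.+1 - j.+1) = (n.+1 - j)%N by rewrite /bump /=; lia.
  rewrite mulrCA exprVn; congr (_ * _).
  have {1}-> : n.+1 = (j + (n.+1 - j))%N by lia.
  by rewrite exprD mulfK ?expf_neq0.
(* The relation in [y] times 1 - q_0, with its top term lowered by [eq']; adding q_0 restores the
   value 1. *)
pose r : {poly K} := \poly_(j < n.+1) ((1 - q`_0) * p`_j + p`_n.+1 * q`_(n.+1 - j)) + (q`_0)%:P.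
have cr i : I r`_i.
  rewrite coefD coefC coef_poly; apply: (submodD hI).
    case: ifP => _; last exact: submod0 hI.
    apply: (submodD hI); apply: (submodM hI) => //; last exact: sI.
    by apply: subringB => //; [exact: subring1 | exact: sI].
  by case: eqP => // _; exact: submod0 hI.
have sr : (size r <= n.+1)%N.
  apply: (leq_trans (size_polyD _ _)); rewrite geq_max size_poly /=.
  by apply: (leq_trans (size_polyC_leq1 _)).
have er : 1 = r.[y].
  rewrite hornerD hornerC horner_poly.
  under eq_bigr => j _ do rewrite mulrDl -!mulrA.
  rewrite big_split /= -!mulr_sumr -eq'.
  have := ep; rewrite (horner_coef_wide _ sp) big_ord_recr /= => h.
  have -> : \sum_(i < n.+1) p`_i * y ^+ i = 1 - p`_n.+1 * y ^+ n.+1.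
    by rewrite {1}h addrK.
  by ring.
by apply: (IH y n.+1 m) => //; exists r.
Qed.

End Subrings.

(** Zorn's lemma for relations in [Prop], with upper bounds asked only of nonempty chains; [t0]
    bounds the empty one. *)
Lemma Zorn_preorder (T : Type) (t0 : T) (le : T -> T -> Prop) :
  (forall t, le t t) -> (forall r s t, le r s -> le s t -> le r t) ->
  (forall A : T -> Prop, (forall s t, A s -> A t -> le s t \/ le t s) ->
     (exists t, A t) -> exists t, forall s, A s -> le s t) ->
  exists t, forall s, le t s -> le s t.
Proof.
move=> le_refl le_trans ub.
have [||A tot|t ht] := @classical_sets.ZL_preorder T t0 (fun s t => `[< le s t >]).
- by move=> t; apply/asboolP.
- by move=> r s t /asboolP h1 /asboolP h2; apply/asboolP; exact: le_trans h1 h2.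
- have [[t1 At1]|nA] := pselect (exists t, A t); last first.
    by exists t0 => s As; case: nA; exists s.
  have [||t ht] := ub A.
  + by move=> s t As At; case: (tot s t As At) => /asboolP; [left | right].
  + by exists t1.
  + by exists t => s As; apply/asboolP; exact: ht.
by exists t => s /asboolP h; apply/asboolP; exact: ht.
Qed.

(** * Chevalley's extension theorem and prescribed centres *)

Section Chevalley.
Variable K : fieldType.
Implicit Types (R T V W P Q I : K -> Prop).

(** Zorn's lemma applies to pairs of a subring and a proper ideal of it, ordered by inclusion in
    both components. If neither [x] nor its inverse lay in a maximal such subring, its ideal would
    become the unit ideal in both extensions, against [adjoin_inv_unit]. *)
Lemma chevalley R I : subring R -> ideal R I -> ~ I 1 ->
  exists V, valring V /\ subset R V /\ subset I (maxid V).
Proof.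
move=> hR hI nI.
pose ok (p : (K -> Prop) * (K -> Prop)) :=
  [/\ subring p.1, ideal p.1 p.2, ~ p.2 1, subset R p.1 & subset I p.2].
pose le (p q : {p | ok p}) :=
  subset (sval p).1 (sval q).1 /\ subset (sval p).2 (sval q).2.
have okRI : ok (R, I) by split.
case: (@Zorn_preorder _ (exist _ _ okRI) le).
- by move=> t; split=> x.
- by move=> r s t [h1 h2] [h3 h4]; split=> x h; [apply/h3/h1 | apply/h4/h2].
- move=> A tot [t0 At0].
  pose B x := exists2 t, A t & (sval t).1 x.
  pose J x := exists2 t, A t & (sval t).2 x.
  have dir s t : A s -> A t -> exists2 u, A u & le s u /\ le t u.
    move=> As At; case: (tot s t As At) => h; [exists t | exists s] => //.
      by split=> //; split=> x.
    by split=> //; split=> x.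
  have okt (t : {p | ok p}) : ok (sval t) := svalP t.
  have okBJ : ok (B, J).
    split; rewrite /=.
    + have [h _ _ _ _] := okt t0.
      split; first by exists t0 => //; exact: subring0.
      split; first by exists t0 => //; exact: subring1.
      split=> x y [s As sx] [t At ty]; have [u Au [[su _] [tu _]]] := dir s t As At;
        have [hu _ _ _ _] := okt u; exists u => //.
        by apply: subringB => //; [exact: su | exact: tu].
      by apply: subringM => //; [exact: su | exact: tu].
    + have [_ [_ h] _ _ _] := okt t0.
      split.
        by move=> x [t At tx]; exists t => //; have [_ [st _] _ _ _] := okt t; exact: st.
      split; first by exists t0 => //; exact: submod0 h.
      split=> x y [s As sx] [t At ty]; have [u Au [[su su2] [tu tu2]]] := dir s t As At;
        have [_ [_ hu] _ _ _] := okt u; exists u => //.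
        by apply: (submodD hu); [exact: su2 | exact: tu2].
      by apply: (submodM hu); [exact: su | exact: tu2].
    + by move=> [t At t1]; have [_ _ h _ _] := okt t.
    + by move=> x Rx; exists t0 => //; have [_ _ _ h _] := okt t0; exact: h.
    + by move=> x Rx; exists t0 => //; have [_ _ _ _ h] := okt t0; exact: h.
  by exists (exist _ _ okBJ) => s As; split=> x hx /=; exists s.
move=> [[V J] okV] maxV; have [/= hV hJ nJ sRV sIJ] := okV.
(* Were J V[x] proper, maximality of the pair would put [x] into [V]. *)
have adj x : ~ V x -> adjoin J x 1.
  move=> nVx; apply: contrapT => nA.
  have J0 : J 0 by case: hJ => _ /submod0.
  have okA : ok (adjoin V x, adjoin J x).
    split=> //=; [exact: adjoin_subring | exact: adjoin_ideal | |].
      by move=> y Ry; apply: adjoin_const; [exact: subring0 | exact: sRV].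
    by move=> y Iy; apply: adjoin_const => //; exact: sIJ.
  case: (maxV (exist _ _ okA)) => [|/= h _].
    split=> y /= hy; apply: adjoin_const => //; exact: subring0.
  by apply/nVx/h; exact: adjoin_gen.
exists V; split; last first.
  split=> // x Ix; have Jx := sIJ _ Ix.
  split; first by case: hJ => + _; apply.
  move=> Vi; have [//|x0] := eqVneq x 0; case: nJ.
  by rewrite -(mulVf x0); case: hJ => _ /submodM; apply.
split=> // x x0; apply: contrapT => /not_orP [nx nix].
apply: nJ; apply: (adjoin_inv_unit hV hJ x0); exact: adj.
Qed.

(** Chevalley's theorem is applied to the localization of [R] at [P], where elements of [R] outside
    [P] are units; the centre on [R] is thus exactly [P]. *)
Lemma val_center R P : subring R -> prime R P ->
  exists V, [/\ valring V, subset R V & forall x, R x -> (maxid V x <-> P x)].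
Proof.
move=> hR hP.
have frac0 s : R s -> ~ P s -> s != 0.
  by move=> _ ns; apply/eqP => s0; apply: ns; rewrite s0; exact: prime0 hP.
pose loc (E : K -> Prop) (x : K) := exists a s, [/\ E a, R s, ~ P s & x = a / s].
have nM s t : R s -> R t -> ~ P s -> ~ P t -> ~ P (s * t).
  by move=> hs ht ns nt /(prime_or hP hs ht) [].
have hR1 := subring1 hR; have nP1 := prime_n1 hP.
have hloc : subring (loc R).
  split; first by exists 0, 1; split=> //; [exact: subring0 | rewrite mul0r].
  split; first by exists 1, 1; split=> //; rewrite divr1.
  split=> _ _ [a [s [ha hs ns ->]]] [b [t [hb ht nt ->]]].
    exists (a * t - b * s), (s * t); split; try exact: nM; try exact: subringM.
      by apply: subringB => //; exact: subringM.
    by field; rewrite !frac0.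
  exists (a * b), (s * t); split; try exact: nM; try exact: subringM.
  by field; rewrite !frac0.
have hid : ideal (loc R) (loc P).
  split; first by move=> _ [a [s [ha hs ns ->]]]; exists a, s; split=> //; exact: prime_sub hP _ ha.
  split; first by exists 0, 1; split=> //; [exact: prime0 hP | rewrite mul0r].
  split=> _ _ [a [s [ha hs ns ->]]] [b [t [hb ht nt ->]]].
    exists (a * t + b * s), (s * t); split; try exact: nM; try exact: subringM.
      by apply: (prime_D hP); exact: prime_mr hP _ _.
    by field; rewrite !frac0.
  exists (a * b), (s * t); split; try exact: nM; try exact: subringM.
    exact: prime_ml hP _ _.
  by field; rewrite !frac0.
have n1 : ~ loc P 1.
  by move=> [a [s [ha hs ns /esym/divr1_eq e]]]; apply: ns; rewrite -e.
have [V [vV [sV cV]]] := chevalley hloc hid n1.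
exists V; split=> // [x Rx|x Rx].
  by apply: sV; exists x, 1; split=> //; rewrite divr1.
split=> [[_ nx]|Px]; last by apply: cV; exists x, 1; split=> //; rewrite divr1.
apply: contrapT => nPx.
have /eqP : x = 0 by apply: nx; apply: sV; exists 1, x; split=> //; rewrite mul1r.
by rewrite (negPf (frac0 _ Rx nPx)).
Qed.

(* A valuation ring below [V] of prescribed larger centre is found by
   applying [val_center] to [R + m_V], which keeps [m_V] inside [W]. *)
Lemma val_below R Q V : subring R -> valring V -> subset R V -> prime R Q ->
  (forall x, R x -> maxid V x -> Q x) ->
  exists W, [/\ valring W, subset W V, subset R W, subset (maxid V) (maxid W)
     & forall x, R x -> (maxid W x <-> Q x)].
Proof.
move=> hR vV sRV hQ cQ.
have hm := maxid_prime vV.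
pose plus (E : K -> Prop) (x : K) := exists a m, [/\ E a, maxid V m & x = a + m].
have m0 : maxid V 0 by exact: prime0 hm.
have sEp E : subset E (plus E) by move=> x Ex; exists x, 0; split=> //; rewrite addr0.
have smp E : E 0 -> subset (maxid V) (plus E).
  by move=> E0 x mx; exists 0, x; split=> //; rewrite add0r.
have hV : subring V by case: vV.
have mM a m b n : V a -> V b -> maxid V m -> maxid V n -> maxid V (a * n + m * b + m * n).
  move=> ha hb hmm hn; have sm := @maxid_sub K V _ hmm; do 2?[apply: (prime_D hm)];
  by [exact: prime_ml hm _ _ | exact: prime_mr hm _ _].
have mB m n : maxid V m -> maxid V n -> maxid V (m - n).
  exact: (submodB hV (prime_submod hm)).
have hR' : subring (plus R).
  split; first by apply: sEp; exact: subring0.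
  split; first by apply: sEp; exact: subring1.
  split=> _ _ [a [m [ha hmm ->]]] [b [n [hb hn ->]]].
    exists (a - b), (m - n); split; [exact: subringB | exact: mB | by ring].
  exists (a * b), (a * n + m * b + m * n); split; [exact: subringM | | by ring].
  by apply: mM => //; exact: sRV.
have Qm a m : R a -> maxid V m -> Q (a + m) -> Q a.
  move=> ha hmm hq; rewrite -[a](addrK m).
  apply: (@submodB _ R) => //; first exact: prime_submod hQ.
  apply: cQ => //; have -> : m = a + m - a by ring.
  by apply: subringB => //; exact: prime_sub hQ _ hq.
have hQ' : prime (plus R) (plus Q).
  split.
    split; first by move=> _ [a [m [ha hmm ->]]]; exists a, m; split=> //; exact: prime_sub hQ _ ha.
    split; first by apply: sEp; exact: prime0 hQ.
    split=> _ _ [a [m [ha hmm ->]]] [b [n [hb hn ->]]].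
      by exists (a + b), (m + n); split; [exact: prime_D hQ _ _ | exact: prime_D hm _ _ | ring].
    exists (a * b), (a * n + m * b + m * n); split; [exact: prime_ml hQ _ _ | | by ring].
    by apply: mM => //; apply: sRV => //; exact: prime_sub hQ _ hb.
  (* Two decompositions of [x] differ by an element of [R] lying in [maxid V], hence in [Q], so
     membership in [plus Q] can be read off any of them. *)
  have inQ x a : plus Q x -> R a -> (exists2 m, maxid V m & x = a + m) -> Q a.
    move=> [b [n [hb hn ->]]] ha [m hmm e].
    have ea : a = b + (n - m) by rewrite addrA e addrK.
    rewrite ea; apply: (prime_D hQ) => //; apply: cQ; last exact: mB.
    have -> : n - m = a - b by rewrite ea; ring.
    by apply: subringB => //; exact: prime_sub hQ _ hb.
  split.
    move=> h; apply: (prime_n1 hQ); apply: (inQ _ _ h); first exact: subring1.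
    by exists 0 => //; rewrite addr0.
  move=> _ _ [a [m [ha hmm ->]]] [b [n [hb hn ->]]] h.
  have /(prime_or hQ ha hb) [h'|h'] : Q (a * b).
    apply: (inQ _ _ h); first exact: subringM.
    exists (a * n + m * b + m * n); last by ring.
    by apply: mM => //; exact: sRV.
  - by left; exists a, m.
  - by right; exists b, n.
have [W [vW sW cW]] := val_center hR' hQ'.
have smW : subset (maxid V) (maxid W).
  move=> x mx; apply/cW; first by apply: smp => //; exact: subring0.
  by apply: smp => //; exact: prime0 hQ.
exists W; split=> //.
(* If [w] were outside [V], its inverse would lie in [maxid V], hence in [maxid W], although [w] is
   in [W]. *)
- move=> w Ww; apply: contrapT => nVw.
  have w0 : w != 0 by apply/eqP => w0; apply: nVw; rewrite w0; exact: subring0.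
  have Vi : V w^-1 by case: vV => _ /(_ w w0) [].
  have : maxid W w^-1.
    apply: smW; split=> //; rewrite invrK => //.
  by case=> _; rewrite invrK => /(_ Ww) /eqP; rewrite invr_eq0 (negPf w0).
- by move=> x Rx; apply: sW; exact: sEp.
- move=> x Rx; split; last by move=> Qx; apply/cW; exact: sEp.
  move/(cW _ (sEp R _ Rx)) => [a [m [Qa hmm e]]].
  rewrite e; apply: (prime_D hQ) => //; apply: cQ => //.
  have -> : m = x - a by rewrite e; ring.
  by apply: subringB => //; exact: prime_sub hQ _ Qa.
Qed.

(** * Chains of primes and valuation rings over them *)

Fixpoint pchain R P (s : seq (K -> Prop)) : Prop :=
  prime R P /\ if s is Q :: s' then psubset P Q /\ pchain R Q s' else True.

Lemma pchain_prime R P s : pchain R P s -> prime R P.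
Proof. by case: s => [|Q s] []. Qed.

Lemma pchain_last R P s : pchain R P s -> prime R (last P s).
Proof. by elim: s P => [|Q s IH] P /= [hP] // [_ /IH]. Qed.

Lemma pchain_sub_last R P s : pchain R P s -> subset P (last P s).
Proof.
elim: s P => [|Q s IH] P /= [hP]; first by move=> _ x.
by move=> [[sPQ _] /IH h] x /sPQ /h.
Qed.

Lemma prime_up W V P : subring W -> subset W V -> prime V P -> subset P W ->
  prime W P.
Proof.
move=> hW sWV hP sPW; split; last first.
  split; first exact: prime_n1 hP.
  by move=> a b ha hb; apply: (prime_or hP); exact: sWV.
split=> //; split; first exact: prime0 hP.
split=> [x y|d x hd]; first exact: prime_D hP.
by apply: (prime_ml hP); exact: sWV.
Qed.

(** Each step shrinks the valuation ring by [val_below]. The earlier maximal ideals remain primes of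
    the final ring, and they are distinct because their centres on [R] are. *)
Lemma val_chain_above R V P s : subring R -> valring V -> subset R V ->
  (forall x, R x -> (maxid V x <-> P x)) -> pchain R P s ->
  exists W s', [/\ valring W, subset W V, subset R W, size s' = size s
    & pchain W (maxid V) s' /\ forall x, R x -> (maxid W x <-> last P s x)].
Proof.
elim: s P V => [|Q s IH] P V hR vV sRV cV /= [hP].
  by exists V, [::]; split=> //; split=> //=; split=> //; exact: maxid_prime.
move=> [[sPQ [z [Qz nPz]]] hc].
have hQ := pchain_prime hc.
have [|V1 [vV1 sV1 sR1 m1 c1]] := val_below hR vV sRV hQ.
  by move=> x Rx mx; apply: sPQ; apply/cV.
have [W [s' [vW sW sRW es [hcW cW]]]] := IH Q V1 hR vV1 sR1 c1 hc.
have hW : subring W by case: vW.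
exists W, (maxid V1 :: s'); split=> //=; first by move=> x /sW /sV1.
  by rewrite es.
split=> //; split.
  apply: (prime_up hW _ (maxid_prime vV)); first by move=> x /sW /sV1.
  by move=> x /m1; exact: prime_sub (pchain_prime hcW) _.
split=> //; split=> //; exists z; split; first by apply/c1 => //; exact: prime_sub hQ _ Qz.
by move/cV => h; apply/nPz/h; exact: prime_sub hQ _ Qz.
Qed.

Lemma val_chain R P s : subring R -> pchain R P s ->
  exists W P' s', [/\ valring W, subset R W, size s' = size s, pchain W P' s'
    & forall x, R x -> (maxid W x <-> last P s x)].
Proof.
move=> hR hc; have [V [vV sV cV]] := val_center hR (pchain_prime hc).
have [W [s' [vW sW sRW es [hcW cW]]]] := val_chain_above hR vV sV cV hc.
by exists W, (maxid V), s'.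
Qed.

Lemma pchainE R P s : pchain R P s <->
  (forall i, (i < (size s).+1)%N -> prime R (nth (@bot K) (P :: s) i)) /\
  (forall i, (i.+1 < (size s).+1)%N ->
     psubset (nth (@bot K) (P :: s) i) (nth (@bot K) (P :: s) i.+1)).
Proof.
elim: s P => [|Q s IH] P.
  by split=> [[hP _]|[h _]]; [split=> [[]|] | split=> //; exact: (h 0%N)].
split=> [[hP [sPQ /IH [h1 h2]]]|[h1 h2]].
  by split=> [[|i] //= /h1|[|i] //= /h2].
split; first exact: (h1 0%N).
by split; [exact: (h2 0%N) | apply/IH; split=> i hi; [exact: (h1 i.+1) | exact: (h2 i.+1)]].
Qed.

Lemma krull_chainE R k :
  krull_chain R k <-> exists P s, size s = k /\ pchain R P s.
Proof.
split=> [[[|P s] [//= [es] h]]|[P [s [es /pchainE h]]]].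
  by exists P, s; split=> //; apply/pchainE; rewrite es.
by exists (P :: s); rewrite /= es; split=> //; rewrite es in h.
Qed.

Lemma krull_chain_le R k m : (k <= m)%N -> krull_chain R m -> krull_chain R k.
Proof.
move=> hk [Ps [es [h1 h2]]]; exists (take k.+1 Ps).
split; first by rewrite size_takel // es.
split=> i hi; rewrite !nth_take //; first by apply: h1; lia.
  by apply: h2; lia.
lia.
Qed.

End Chevalley.

(** * Rational functions and algebraic dependence *)

Lemma fraction_div (R : idomainType) (z : {fraction R}) :
  exists p q : R, q != 0 /\ z = tofrac p / tofrac q.
Proof.
exists (\n_(repr z)), (\d_(repr z)); split; first exact: denom_ratioP.
apply/(canRL (mulfK _)); first by rewrite tofrac_eq0 denom_ratioP.
rewrite -{1}[z]reprK; unlock FracField.tofrac; rewrite -[LHS]FracField.pi_mul.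
apply/eqmodP; rewrite /= FracField.equivfE /FracField.mulf !numden_Ratio ?oner_neq0 ?mulr1 ?denom_ratioP //.
by rewrite mulrC.
Qed.

(* [L] plays the role of [{fraction {poly K}}]; keeping it abstract stops
   [field] from unfolding the quotient. *)
Section RationalFunctions.
Variables (K L : fieldType) (tf : {rmorphism {poly K} -> L}).
Hypothesis tf_eq0 : forall p, (tf p == 0) = (p == 0).
Hypothesis tf_div : forall z, exists p q, q != 0 /\ z = tf p / tf q.

Definition cst (a : K) : L := tf a%:P.

Lemma cst_is_zmod : zmod_morphism cst.
Proof. by move=> a b; rewrite /cst polyCB rmorphB. Qed.
Lemma cst_is_monoid : monoid_morphism cst.
Proof. by split=> [|a b]; rewrite /cst ?polyCM ?rmorphM // rmorph1. Qed.
HB.instance Definition _ := GRing.isZmodMorphism.Build K L cst cst_is_zmod.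
HB.instance Definition _ := GRing.isMonoidMorphism.Build K L cst cst_is_monoid.

(** This product is what the [i]-th power of [p / q] becomes after multiplication by the [N]-th
    power of [q]. *)
Lemma size_expM (p q : {poly K}) m i N : (size p <= m)%N -> (size q <= m)%N ->
  (i <= N)%N -> (size (p ^+ i * q ^+ (N - i))%R <= (m * N).+1)%N.
Proof.
move=> hp hq hi; apply: (leq_trans (size_polyMleq _ _)).
have := size_poly_exp_leq p i; have := size_poly_exp_leq q (N - i).
have : ((size p).-1 * i <= m * i)%N by rewrite leq_mul2r; apply/orP; right; lia.
have : ((size q).-1 * (N - i) <= m * (N - i))%N by rewrite leq_mul2r; apply/orP; right; lia.
have -> : (m * N = m * i + m * (N - i))%N by rewrite -mulnDr subnKC.
set u := size _; set v := size (q ^+ _); lia.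
Qed.

(** The coefficient matrix has more rows than columns, so its left kernel is nonzero. *)
Lemma poly_dependent (T : finType) (P : T -> {poly K}) S :
  (forall t, (size (P t) <= S)%N) -> (S < #|T|)%N ->
  exists c : T -> K, (exists t, c t != 0) /\ \sum_t c t *: P t = 0.
Proof.
move=> hP hS; pose A : 'M[K]_(#|T|, S) := \matrix_(r, k) (P (enum_val r))`_k.
have : kermx A != 0.
  by rewrite kermx_eq0 /row_free neq_ltn (leq_ltn_trans (rank_leq_col A)).
case/rowV0Pn => u /sub_kermxP uA u0.
exists (fun t => u 0 (enum_rank t)); split.
  case/rV0Pn: u0 => j hj.
  by exists (enum_val j); rewrite enum_valK.
apply/polyP => k; rewrite coef0 coef_sum.
have [hk|hk] := ltnP k S; last first.
  apply: big1 => t _; rewrite coefZ nth_default ?mulr0 //.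
  exact: leq_trans (hP t) hk.
have := congr1 (fun M : 'rV_S => M 0 (Ordinal hk)) uA; rewrite !mxE => e0.
rewrite -[RHS]e0.
rewrite (reindex (@enum_val T T)) /=; last first.
  by exists enum_rank => x _; [exact: enum_valK | exact: enum_rankK].
by apply: eq_bigr => r _; rewrite coefZ mxE enum_valK.
Qed.

(** Over a common denominator the monomials in [x] and [y] have numerators of degree linear in [N],
    while their number is quadratic in [N]. *)
Lemma alg_dependent (x y : L) :
  exists N (c : 'I_N * 'I_N -> K), (exists t, c t != 0) /\
    \sum_t cst (c t) * x ^+ t.1 * y ^+ t.2 = 0.
Proof.
have [a [b [b0 ex]]] := tf_div x; have [e [d [d0 ey]]] := tf_div y.
pose m := (size a + size b + size e + size d)%N.
(* With this [N] and [m > 0], the N^2 monomials outnumber the 2mN + 1 coefficients of their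
   numerators. *)
pose N := (2 * m).+1.
pose P (t : 'I_N * 'I_N) := (a ^+ t.1 * b ^+ (N - t.1)) * (e ^+ t.2 * d ^+ (N - t.2)).
have m0 : (0 < m)%N by have := b0; rewrite -size_poly_gt0 /m; lia.
have [||c [c0 hc]] := @poly_dependent _ P (2 * m * N).+1.
- move=> [i j]; apply: (leq_trans (size_polyMleq _ _)) => /=.
  have h1 : (size (a ^+ i * b ^+ (N - i))%R <= (m * N).+1)%N.
    by apply: size_expM; [rewrite /m; lia | rewrite /m; lia | exact/ltnW/ltn_ord].
  have h2 : (size (e ^+ j * d ^+ (N - j))%R <= (m * N).+1)%N.
    by apply: size_expM; [rewrite /m; lia | rewrite /m; lia | exact/ltnW/ltn_ord].
  move: h1 h2; set u := size _; set v := size (_ * d ^+ _); lia.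
- rewrite card_prod card_ord /N; nia.
exists N, c; split=> //.
have tb0 : tf b != 0 by rewrite tf_eq0.
have td0 : tf d != 0 by rewrite tf_eq0.
apply: (mulIf (mulf_neq0 (expf_neq0 N tb0) (expf_neq0 N td0))).
rewrite mul0r -[RHS](rmorph0 tf) -hc rmorph_sum mulr_suml; apply: eq_bigr => -[i j] _ /=.
rewrite -mul_polyC rmorphM /P /cst !rmorphM !rmorphXn /= -!mulrA; congr (_ * _).
have split_pow (f : L) (k : 'I_N) : f ^+ N = f ^+ k * f ^+ (N - k).
  by rewrite -exprD subnKC // ltnW.
rewrite ex ey !exprMn (split_pow (tf b) i) (split_pow (tf d) j) !exprVn.
by field; rewrite !expf_neq0.
Qed.

(** * Restricting a valuation ring to the coefficient field *)

Section Valuation.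
Variable W : L -> Prop.
Hypothesis vW : valring W.

Let hW : subring W := proj1 vW.
Let mP := maxid_prime vW.

(* In a nonempty sum of terms with pairwise distinct values one term
   dominates, so the sum does not vanish. *)
Lemma dominant_sum (I : eqType) (r : seq I) (F : I -> L) : r != [::] -> uniq r ->
  (forall i, i \in r -> F i != 0) ->
  (forall i j, i \in r -> j \in r -> i != j -> W (F i / F j) -> W (F j / F i) -> False) ->
  exists i m, [/\ i \in r, maxid W m & \sum_(k <- r) F k = F i * (1 + m)].
Proof.
elim: r => // i [|j r] IH _ ur F0 nu.
  by exists i, 0; split; rewrite ?mem_head ?big_seq1 ?addr0 ?mulr1 //; exact: prime0 mP.
have sub k : k \in j :: r -> k \in i :: j :: r by move=> h; rewrite inE h orbT.
have [||||l [m [lr mm es]]] := IH _.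
- by [].
- by move: ur => /= /andP [].
- by move=> k /sub; exact: F0.
- by move=> k l /sub hk /sub hl; exact: nu.
have hi : i \in i :: j :: r by exact: mem_head.
have il : i != l by apply/eqP => e; move: ur => /=; rewrite e lr.
have [Fi0 Fl0] := (F0 _ hi, F0 _ (sub _ lr)).
have V1m : W (1 + m) by apply: subringD => //; [exact: subring1 | exact: maxid_sub].
rewrite big_cons es.
have [h|h] : W (F i / F l) \/ W (F l / F i).
  by rewrite -[F l / F i]invf_div; apply: (proj2 vW); rewrite mulf_neq0 ?invr_eq0.
- exists l, (m + F i / F l); split; [exact: sub| |by field].
  apply: (prime_D mP) => //; split=> //; rewrite invf_div => h'.
  by case: (nu i l hi (sub _ lr) il h h').
- exists i, (F l / F i * (1 + m)); split=> //; last by field.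
  apply: (prime_mr mP) => //; split=> //; rewrite invf_div => h'.
  by case: (nu i l hi (sub _ lr) il h' h).
Qed.

Definition wunit (z : L) := W z /\ W z^-1.

(** The value of [z] is not that of a constant: if [cst e * z] were a unit, [cst e^-1] would lie in
    [Q] together with [z], hence in [P], and would carry [z] into [P]. *)
Lemma cst_mul_not_unit P Q (z : L) e : prime W P -> prime W Q ->
  (forall a, Q (cst a) -> P (cst a)) -> Q z -> ~ P z -> e != 0 ->
  wunit (cst e * z) -> False.
Proof.
move=> hP hQ hc Qz nPz e0 [u1 u2]; apply: (nPz).
have z0 : z != 0 by apply/eqP => z0; apply: nPz; rewrite z0; exact: prime0 hP.
have ce0 : cst e != 0 by rewrite fmorph_eq0.
have Pe : P (cst e^-1).
  apply: hc; have -> : cst e^-1 = (cst e * z)^-1 * z.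
    by rewrite fmorphV; field; rewrite z0 ce0.
  exact: prime_ml hQ _ _.
have -> : z = cst e * z * cst e^-1 by rewrite fmorphV; field.
exact: prime_ml hP _ _.
Qed.

Lemma wunitV z : wunit z -> wunit z^-1.
Proof. by move=> [h1 h2]; split; rewrite ?invrK. Qed.

(** Otherwise [y / z] lies in [W] and [y] is a multiple of [z], hence in [P]. *)
Lemma prime_divides P y z : prime W P -> W y -> W z -> P z -> ~ P y -> W (z / y).
Proof.
move=> hP hy hz Pz nPy.
have y0 : y != 0 by apply/eqP => y0; apply: nPy; rewrite y0; exact: prime0 hP.
have [->|z0] := eqVneq z 0; first by rewrite mul0r; exact: subring0.
have zy0 : z / y != 0 by rewrite mulf_neq0 ?invr_eq0.
case: (proj2 vW _ zy0) => //; rewrite invf_div => h; case: nPy.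
by rewrite -(divfK z0 y); exact: prime_ml hP _ _.
Qed.

(* If two steps of a chain of primes of [W] collapsed in [K], elements [x], [y]
   witnessing them would have values independent over those of [K], against
   the transcendence degree of [K(X)] over [K] being one. *)
Lemma one_collapse P Q P' Q' : prime W P -> prime W Q -> prime W P' -> prime W Q' ->
  psubset P Q -> subset Q P' -> psubset P' Q' ->
  (forall a, Q (cst a) -> P (cst a)) -> (forall a, Q' (cst a) -> P' (cst a)) -> False.
Proof.
move=> hP hQ hP' hQ' [sPQ [x [Qx nPx]]] sQP [_ [y [Qy nPy]]] cPQ cPQ'.
have [Wx Wy] := (prime_sub hQ Qx, prime_sub hQ' Qy).
have x0 : x != 0 by apply/eqP => x0; apply: nPx; rewrite x0; exact: prime0 hP.
have y0 : y != 0 by apply/eqP => y0; apply: nPy; rewrite y0; exact: prime0 hP'.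
have nQy : ~ Q y by move/sQP.
have nPy1 : ~ P y by move/sPQ.
have yn n : W (y ^+ n) by exact: subringX.
have caseA e a b : e != 0 -> wunit (cst e * (x ^+ a.+1 * y ^+ b)) -> False.
  apply: (cst_mul_not_unit hP hQ cPQ).
    by apply: (prime_mr hQ) => //; exact: prime_Xn hQ _.
  move/(prime_or hP (subringX _ hW Wx) (yn b)) => [/(prime_X hW hP Wx)//|].
  by move/(prime_X hW hP Wy).
(* The quotient exists in [W] because [x] lies in [P'] and [y] does not; it lies in [Q] since [y] is
   outside [Q], and not in [P] since [x] is outside [P]. *)
have caseB e a b : e != 0 -> wunit (cst e * (x ^+ a.+1 / y ^+ b)) -> False.
  have yb0 : y ^+ b != 0 by rewrite expf_neq0.
  have Qxa : Q (x ^+ a.+1) by exact: prime_Xn hQ _.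
  have Wz : W (x ^+ a.+1 / y ^+ b).
    apply: (prime_divides hP') => //; first exact: subringX.
      exact: sQP.
    by move/(prime_X hW hP' Wy).
  apply: (cst_mul_not_unit hP hQ cPQ).
    have : Q (x ^+ a.+1 / y ^+ b * y ^+ b) by rewrite divfK.
    by case/(prime_or hQ Wz (yn b)) => // /(prime_X hW hQ Wy).
  move=> Pz; apply: nPx; apply: (@prime_X _ W P x a.+1) => //.
  by rewrite -(divfK yb0 (x ^+ a.+1)); exact: prime_mr hP _ _.
have caseC e b : e != 0 -> wunit (cst e * y ^+ b.+1) -> False.
  apply: (cst_mul_not_unit hP' hQ' cPQ'); first exact: prime_Xn hQ' _.
  by move/(prime_X hW hP' Wy).
have [N [c [[t0 ct0] hc]]] := alg_dependent x y.
pose F (t : 'I_N * 'I_N) := cst (c t) * x ^+ t.1 * y ^+ t.2.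
(* Monomials with different exponents have different values: ordering the exponents
   lexicographically gives their quotient one of the three shapes above. *)
have key i j k l e e' : e != 0 -> e' != 0 -> (i, j) <> (k, l) :> nat * nat ->
    wunit ((cst e * x ^+ i * y ^+ j) / (cst e' * x ^+ k * y ^+ l)) -> False.
  wlog : i j k l e e' / (k < i)%N \/ k = i /\ (l < j)%N.
    move=> H e0 e0' ne hu.
    have [hik|hik|hik] := ltngtP k i; first by apply: (H i j k l e e') => //; left.
      apply: (H k l i j e' e) => //; first by left.
        by move=> [h _]; move: hik; rewrite h ltnn.
      by rewrite -invf_div; exact: wunitV.
    have [hjl|hjl|hjl] := ltngtP l j; first by apply: (H i j k l e e') => //; right.
      apply: (H k l i j e' e) => //; first by right.
        by move=> [_ h]; move: hjl; rewrite h ltnn.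
      by rewrite -invf_div; exact: wunitV.
    by apply: ne; rewrite hik hjl.
  move=> H e0 e0' _ hu.
  have ee0 : e / e' != 0 by rewrite mulf_neq0 ?invr_eq0.
  have [ce0 ce0'] : cst e != 0 /\ cst e' != 0 by rewrite !fmorph_eq0.
  have [xk0 yl0 yj0] : [/\ x ^+ k != 0, y ^+ l != 0 & y ^+ j != 0] by rewrite !expf_neq0.
  case: H => [hik|[eki hlj]].
    have ei : i = (k + (i - k.+1).+1)%N by rewrite -addSnnS subnKC.
    have [hjl|hjl] := leqP l j.
      apply: (caseA (e / e') (i - k.+1)%N (j - l)%N ee0).
      have ej : j = (l + (j - l))%N by rewrite subnKC.
      move: hu; rewrite {1}ei {1}ej !exprD fmorph_div; congr (wunit _).
      by field; rewrite ce0' xk0 yl0.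
    apply: (caseB (e / e') (i - k.+1)%N (l - j)%N ee0).
    have el : l = (j + (l - j))%N by rewrite subnKC // ltnW.
    move: hu; rewrite {1}ei {1}el !exprD fmorph_div; congr (wunit _).
    by field; rewrite ce0' xk0 yj0 !expf_neq0.
  apply: (caseC (e / e') (j - l.+1)%N ee0).
  have ej : j = (l + (j - l.+1).+1)%N by rewrite -addSnnS subnKC.
  move: hu; rewrite -eki {1}ej !exprD fmorph_div; congr (wunit _).
  by field; rewrite ce0' xk0 yl0.
(* Only terms with nonzero coefficient compete; a dominant one makes the vanishing sum
   [F t * (1 + m)], forcing -1 into the maximal ideal. *)
have [||||t [m [ht mm es]]] := @dominant_sum _ [seq t <- enum {: 'I_N * 'I_N} | c t != 0] F.
- apply/eqP => h; have : t0 \in [seq t <- enum {: 'I_N * 'I_N} | c t != 0].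
    by rewrite mem_filter ct0 mem_enum.
  by rewrite h.
- by rewrite filter_uniq // enum_uniq.
- by move=> t; rewrite mem_filter => /andP [ct _]; rewrite /F !mulf_neq0 ?expf_neq0 ?fmorph_eq0.
- move=> [i j] [k l]; rewrite !mem_filter => /andP [c1 _] /andP [c2 _] ne h1 h2.
  apply: (key i j k l (c (i, j)) (c (k, l))) => //.
    move=> [/ord_inj e1 /ord_inj e2]; by move: ne; rewrite e1 e2 eqxx.
  by split=> //; rewrite invf_div.
have : F t * (1 + m) = 0.
  rewrite -es big_filter big_enum_cond /= -[RHS]hc [RHS](bigID (fun t => c t != 0)) /=.
  rewrite [X in _ + X]big1 ?addr0 //.
  by move=> s; rewrite negbK => /eqP ->; rewrite rmorph0 !mul0r.
move: ht; rewrite mem_filter => /andP [ct _].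
move/eqP; rewrite mulf_eq0 /F !mulf_eq0 !expf_eq0 (negPf x0) (negPf y0) !andbF !orbF.
rewrite fmorph_eq0 (negPf ct) /= => /eqP h.
apply: (prime_n1 mP); have -> : 1 = - m by rewrite -[LHS](addrK m) h add0r.
exact: prime_N mP _.
Qed.

Definition ctr (P : L -> Prop) : K -> Prop := fun a => P (cst a).

Lemma ctr_valring : valring (ctr W).
Proof.
split; last by move=> x x0; rewrite /ctr fmorphV; apply: (proj2 vW); rewrite fmorph_eq0.
split; first by rewrite /ctr rmorph0; exact: subring0.
split; first by rewrite /ctr rmorph1; exact: subring1.
split=> x y; rewrite /ctr ?rmorphB ?rmorphM; [exact: subringB | exact: subringM].
Qed.

Lemma ctr_maxid a : maxid (ctr W) a <-> maxid W (cst a).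
Proof.
rewrite /maxid /ctr fmorphV; split=> -[h1 h2]; split=> // h.
  by rewrite (h2 h) rmorph0.
by apply/eqP; rewrite -(fmorph_eq0 cst); apply/eqP; exact: h2.
Qed.

Lemma ctr_prime P : prime W P -> prime (ctr W) (ctr P).
Proof.
move=> hP; split; last first.
  split; first by rewrite /ctr rmorph1; exact: prime_n1 hP.
  by move=> a b; rewrite /ctr rmorphM; exact: prime_or hP.
split; first by move=> x; exact: prime_sub hP _.
split; first by rewrite /ctr rmorph0; exact: prime0 hP.
by split=> x y; rewrite /ctr ?rmorphD ?rmorphM; [exact: prime_D hP | exact: prime_ml hP].
Qed.

(** The collapse from [P] to [Q] uses up the one allowed by [one_collapse], so every step above [Q]
    stays strict. *)
Lemma ctr_pchain P Q R s : prime W P -> prime W Q -> psubset P Q ->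
  (forall a, Q (cst a) -> P (cst a)) -> subset Q R -> pchain W R s ->
  pchain (ctr W) (ctr R) (map ctr s).
Proof.
move=> hP hQ sPQ cPQ; elim: s R => [|R' s IH] R sQR [hR]; first by split=> //; exact: ctr_prime.
move=> [sRR hc]; split; first exact: ctr_prime.
split; last by apply: IH => // x /sQR; exact: (proj1 sRR).
split; first by move=> a; exact: (proj1 sRR).
apply: contrapT => h; apply: (one_collapse hP hQ hR (pchain_prime hc)) => // a Ra.
by apply: contrapT => nR; apply: h; exists a.
Qed.

Lemma ctr_chain P s : pchain W P s ->
  exists s', (size s <= (size s').+1)%N /\ pchain (ctr W) (ctr P) s'.
Proof.
elim: s P => [|Q s IH] P [hP]; first by exists [::]; split=> //; split=> //; exact: ctr_prime.
move=> [sPQ hc]; have hQ := pchain_prime hc.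
(* If the first step survives, the induction continues; if it collapses, [ctr P] equals [ctr Q] and
   the rest contracts without loss. *)
have [h|h] := pselect (exists a, ctr Q a /\ ~ ctr P a).
  have [s' [es hs']] := IH Q hc.
  exists (ctr Q :: s'); split=> //; split; first exact: ctr_prime.
  by split=> //; split=> // a; exact: (proj1 sPQ).
have cPQ a : Q (cst a) -> P (cst a).
  by move=> Qa; apply: contrapT => nP; apply: h; exists a.
exists (map ctr s); split; first by rewrite /= size_map.
have -> : ctr P = ctr Q.
  by apply/predeqP => a; split; [exact: (proj1 sPQ) | exact: cPQ].
by apply: (ctr_pchain hP hQ).
Qed.

End Valuation.

Lemma krull_chain_ctr W k : valring W -> krull_chain W k ->
  exists k', (k <= k'.+1)%N /\ krull_chain (ctr W) k'.
Proof.
move=> vW /krull_chainE [P [s [<- hc]]].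
have [s' [hs hc']] := ctr_chain vW hc.
by exists (size s'); split=> //; apply/krull_chainE; exists (ctr P), s'.
Qed.

End RationalFunctions.

(** * Finitely generated modules and admissible primes *)

Section Admissible.
Variable K : fieldType.
Implicit Types (D R T V P Q I E : K -> Prop) (star : (K -> Prop) -> (K -> Prop)).

(** Coefficients given by a function spare the bookkeeping of list lengths. *)
Lemma fgenP R s y : fgen R s y <-> exists c : nat -> K,
  (forall i, (i < size s)%N -> R (c i)) /\ y = \sum_(i < size s) c i * s`_i.
Proof.
split=> [[c [_ h]]|[c [hc ->]]]; first by exists (fun i => c`_i).
exists (mkseq c (size s)); rewrite size_mkseq; split=> //; split=> [i hi|].
  by rewrite nth_mkseq //; exact: hc.
by apply: eq_bigr => i _; rewrite nth_mkseq.
Qed.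

Lemma fgen_nth R s i : subring R -> fgen R s s`_i.
Proof.
move=> hR; apply/fgenP; have [hi|hi] := ltnP i (size s).
  exists (fun j => (j == i)%:R); split.
    by move=> j _; case: (j == i); [exact: subring1 | exact: subring0].
  rewrite (bigD1 (Ordinal hi)) //= eqxx mul1r big1 ?addr0 // => j.
  by rewrite -val_eqE /= => /negPf ->; rewrite mul0r.
exists (fun=> 0); split; first by move=> j _; exact: subring0.
by rewrite nth_default // big1 // => j _; rewrite mul0r.
Qed.

Lemma fgen_mem R s x : subring R -> x \in s -> fgen R s x.
Proof. by move=> hR hx; rewrite -(nth_index 0 hx); exact: fgen_nth. Qed.

Lemma fgen_submod R s : subring R -> submod R (fgen R s).
Proof.
move=> hR; split.
  apply/fgenP; exists (fun=> 0); split; first by move=> j _; exact: subring0.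
  by rewrite big1 // => j _; rewrite mul0r.
split=> x y; last first.
  move=> hx /fgenP [c [hc ->]]; apply/fgenP; exists (fun i => x * c i); split.
    by move=> i hi; apply: subringM => //; exact: hc.
  by rewrite mulr_sumr; apply: eq_bigr => i _; rewrite mulrA.
move=> /fgenP [c [hc ->]] /fgenP [d [hd ->]]; apply/fgenP.
exists (fun i => c i + d i); split.
  by move=> i hi; apply: subringD => //; [exact: hc | exact: hd].
by rewrite -big_split; apply: eq_bigr => i _; rewrite mulrDl.
Qed.

Lemma fgen_sub R s I : submod R I -> (forall i, (i < size s)%N -> I s`_i) ->
  subset (fgen R s) I.
Proof.
move=> hI hs _ /fgenP [c [hc ->]]; apply: (submod_sum _ hI) => i _.
by apply: (submodM hI); [exact: hc | exact: hs].
Qed.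

Lemma fgen_subring_le R T s : subset R T -> subset (fgen R s) (fgen T s).
Proof.
move=> sRT _ /fgenP [c [hc ->]]; apply/fgenP; exists c; split=> // i hi.
by apply: sRT; exact: hc.
Qed.

Lemma fgen_Fbar D s : subring D -> fgnz s -> Fbar D (fgen D s).
Proof.
by move=> hD [x [xs x0]]; split; [exact: fgen_submod | exists x; split=> //; exact: fgen_mem].
Qed.

(* All that the translation of [Theta] needs of a semistar operation; unlike the
   semistar axioms it is quickly verified for [starX]. *)
Definition unit_law D star :=
  [/\ forall s, fgnz s -> subset (fgen D s) D ->
        subset (star (fgen D s)) (star D),
      star D 1
    & forall s, fgnz s -> subset (fgen D s) D -> star (fgen D s) 1 ->
        subset (star D) (star (fgen D s))].

Lemma subring_Fbar D : subring D -> Fbar D D.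
Proof.
move=> hD; split; first exact: subring_submod.
by exists 1; split; [exact: subring1 | exact: oner_neq0].
Qed.

Lemma semistar_sub_star D star s E : subring D -> semistar D star -> fgnz s ->
  Fbar D E -> subset (fgen D s) (star E) -> subset (star (fgen D s)) (star E).
Proof.
move=> hD [hF [_ [hmon [_ hidem]]]] hs hE h x hx.
apply: (proj1 (hidem _ hE)); apply: hmon hx => //; [exact: fgen_Fbar | exact: hF].
Qed.

(** For the last clause, 1 in F^star puts [D] inside F^star, and idempotence absorbs the second
    closure. *)
Lemma semistar_unit_law D star : subring D -> semistar D star -> unit_law D star.
Proof.
move=> hD [hF [_ [hmon [hext hidem]]]]; have hDD := subring_Fbar hD.
split=> [s hs hsub||s hs hsub h1].
- by apply: hmon => //; exact: fgen_Fbar.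
- by apply: hext => //; exact: subring1.
have hFs := fgen_Fbar hD hs; have [hsm _] := hF _ hFs.
move=> x hx; apply: (proj1 (hidem _ hFs)); apply: hmon hx => //; first exact: hF.
by move=> d hd; rewrite -[d]mulr1; exact: submodM hsm _ _.
Qed.

Lemma star_f_le D star I J : subset I J -> subset (star_f D star I) (star_f D star J).
Proof. by move=> h x [s [hs [sI hx]]]; exists s; split=> //; split=> // y /sI /h. Qed.

(** This turns the strict inclusion in [Theta] into a condition on 1: a module F inside [I] with 1
    in F^star already has all of [star D] in F^star. *)
Lemma psubset_star_f D star I : unit_law D star -> subset I D ->
  (psubset (star_f D star I) (star D) <-> ~ star_f D star I 1).
Proof.
move=> [hmon h1 hD] sID; split=> [[_ [x [hx nx]]] [s [hs [sI hs1]]]|h].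
  apply: nx; exists s; split=> //; split=> //; apply: hD => // y /sI; exact: sID.
split; last by exists 1.
by move=> x [s [hs [sI hx]]]; apply: hmon hx => // y /sI; exact: sID.
Qed.

Definition admissible D star P :=
  prime D P /\ ((forall x, P x -> x = 0) \/ ~ star_f D star P 1).

Lemma admissible_sub D star P Q : prime D P -> subset P Q -> admissible D star Q ->
  admissible D star P.
Proof.
move=> hP sPQ [_ [h|h]]; split=> //; first by left=> x /sPQ; exact: h.
by right => /(star_f_le sPQ).
Qed.

End Admissible.

(** * Quasi-primes of the polynomial extension *)

Section PolynomialExtension.
Variable K : fieldType.
Variable D : K -> Prop.
Variable star : (K -> Prop) -> (K -> Prop).
Local Notation KX := {fraction {poly K}}.
Local Notation tf := (@tofrac {poly K}).
Hypothesis hD : subring D.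

Lemma tf_inj : injective tf.
Proof. by move=> p q /eqP; rewrite tofrac_eq => /eqP. Qed.

Lemma polyD_coef p i : polyD D (tf p) -> D p`_i.
Proof. by move=> [q [hq /tf_inj ->]]. Qed.

Lemma polyD_const a : polyD D (tf a%:P) <-> D a.
Proof.
split=> [/(@polyD_coef _ 0)|ha]; first by rewrite coefC.
by exists a%:P; split=> // i; rewrite coefC; case: ifP => // _; exact: subring0.
Qed.

Lemma polyD_subring : subring (polyD D).
Proof.
have hc c : D c -> polyD D (tf c%:P) by move/polyD_const.
split; first by rewrite -(rmorph0 tf); apply: hc; exact: subring0.
split; first by rewrite -(rmorph1 tf); apply: hc; exact: subring1.
split=> _ _ [p [hp ->]] [q [hq ->]].
  by exists (p - q); split=> [i|]; rewrite ?rmorphB // coefB; exact: subringB.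
exists (p * q); split=> [i|]; last by rewrite rmorphM.
rewrite coefM; apply: submod_sum; first exact: subring_submod.
by move=> j _; exact: subringM.
Qed.

Lemma common_denominator (s : seq K) : quotient_field_of D ->
  exists d, [/\ D d, d != 0 & forall x, x \in s -> D (d * x)].
Proof.
move=> hq; elim: s => [|x s [d [hd d0 hs]]].
  by exists 1; split=> //; [exact: subring1 | exact: oner_neq0].
have [a [b [ha [hb [b0 ->]]]]] := hq x.
exists (b * d); split; [exact: subringM | exact: mulf_neq0 |].
move=> y; rewrite inE => /orP [/eqP ->|ys].
  have -> : b * d * (a / b) = d * a by field.
  exact: subringM.
by rewrite -mulrA; apply: subringM => //; exact: hs.
Qed.

Lemma polyD_quotient_field : quotient_field_of D -> quotient_field_of (polyD D).
Proof.
move=> hq z; have [p [q [q0 ->]]] := fraction_div z.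
have [d [hd d0 hs]] := common_denominator (p ++ q) hq.
have hc (r : {poly K}) : {subset (r : seq K) <= p ++ q} -> polyD D (tf (d *: r)).
  move=> hr; exists (d *: r); split=> // i; rewrite coefZ.
  have [hi|hi] := ltnP i (size r); first by apply/hs/hr/mem_nth.
  by rewrite nth_default // mulr0; exact: subring0.
exists (tf (d *: p)), (tf (d *: q)); split; first by apply: hc => x; rewrite mem_cat => ->.
split; first by apply: hc => x; rewrite mem_cat orbC => ->.
rewrite tofrac_eq0 scaler_eq0 negb_or d0 q0; split=> //.
rewrite -!mul_polyC !rmorphM /= invfM mulrACA divff ?mul1r //.
by rewrite tofrac_eq0 polyC_eq0.
Qed.

Definition con (Q : KX -> Prop) : K -> Prop := fun a => D a /\ Q (tf a%:P).

Lemma con_prime Q : prime (polyD D) Q -> prime D (con Q).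
Proof.
move=> hQ; split.
  split; first by move=> x [].
  split; first by split; [exact: subring0 | rewrite rmorph0; exact: prime0 hQ].
  split=> [x y [hx qx] [hy qy]|d x hd [hx qx]].
    by split; [exact: subringD | rewrite polyCD rmorphD; exact: prime_D hQ _ _].
  split; [exact: subringM | rewrite polyCM rmorphM; apply: (prime_ml hQ) => //].
  exact/polyD_const.
split=> [[_]|a b ha hb [_]]; first by rewrite rmorph1; exact: prime_n1 hQ.
rewrite polyCM rmorphM => /(prime_or hQ) []; try exact/polyD_const.
  by left.
by right.
Qed.

Lemma con_sub Q : subset (con Q) D. Proof. by move=> x []. Qed.

Hypothesis hstar : unit_law D star.

Lemma ThetaE Q : Theta D star Q <->
  prime (polyD D) Q /\ admissible D star (con Q).
Proof.
rewrite /Theta /admissible; split=> -[hQ h]; split=> //.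
  split; first exact: con_prime.
  case: h => [h|/(psubset_star_f hstar (@con_sub Q)) h]; last by right.
  by left=> x [hx qx]; exact: h.
case: h => _ [h|/(psubset_star_f hstar (@con_sub Q)) h]; last by right.
by left=> x hx qx; exact: h.
Qed.

(** Some F inside the contraction of [Q] has 1 in F^star. Its generators become the coefficients of
    [g]; a prime in [Theta] containing them all would contain F. *)
Lemma Sset_of_not_Theta Q : prime (polyD D) Q -> ~ Theta D star Q ->
  exists g : {poly KX}, [/\ Sset D star g, forall i, Q g`_i & fgnz g].
Proof.
move=> hQ nT.
have [[s [hs [sQ h1]]]|h] := pselect (star_f D star (con Q) 1); last first.
  by case: nT; apply/ThetaE; split=> //; split; [exact: con_prime | right].
pose g : {poly KX} := \poly_(i < size s) tf (s`_i)%:P.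
have gE i : g`_i = tf (s`_i)%:P.
  rewrite coef_poly; case: ltnP => // hi; by rewrite nth_default ?rmorph0.
have sD i : con Q s`_i by apply: sQ; exact: fgen_nth.
exists g; split.
- split=> [i|Q' /ThetaE [hQ' [_ hc]] hg].
    by rewrite gE; apply/polyD_const; case: (sD i).
  have sQ' : subset (fgen D s) (con Q').
    apply: fgen_sub; first exact: prime_submod (con_prime hQ').
    by move=> i _; split; [case: (sD i) | rewrite -gE].
  case: hc => [h|h].
    case: hs => x [xs]; rewrite (h x) ?eqxx //.
    by apply: sQ'; exact: fgen_mem.
  by apply: h; exists s.
- by move=> i; rewrite gE; case: (sD i).
case: hs => x [xs x0]; exists (tf x%:P); split; last by rewrite tofrac_eq0 polyC_eq0.
have gx : g`_(index x s) = tf x%:P by rewrite gE nth_index.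
rewrite -gx; apply: mem_nth; rewrite ltnNge; apply/negP => h.
by move: gx; rewrite nth_default // => /esym/eqP; rewrite tofrac_eq0 polyC_eq0 (negPf x0).
Qed.

(* Gauss' lemma for the extended prime [Q[Y]]. *)
Lemma prime_poly_mul (L : fieldType) (R Q : L -> Prop) (g h : {poly L}) :
  subring R -> prime R Q -> (forall i, R g`_i) -> (forall i, R h`_i) ->
  (forall i, Q (g * h)`_i) -> (forall i, Q g`_i) \/ (forall i, Q h`_i).
Proof.
move=> hR hQ Rg Rh Qgh; apply: contrapT => /not_orP [/existsNP [i0 ni] /existsNP [j0 nj]].
have hg : exists i, `[< ~ Q g`_i >] by exists i0; apply/asboolP.
have hh : exists i, `[< ~ Q h`_i >] by exists j0; apply/asboolP.
case: (ex_minnP hg) => i /asboolP nQi mini {i0 ni}.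
case: (ex_minnP hh) => j /asboolP nQj minj {j0 nj}.
have lti k : (k < i)%N -> Q g`_k.
  move=> hk; apply: contrapT => nk.
  have : (i <= k)%N by apply: mini; apply/asboolP.
  by rewrite leqNgt hk.
have ltj k : (k < j)%N -> Q h`_k.
  move=> hk; apply: contrapT => nk.
  have : (j <= k)%N by apply: minj; apply/asboolP.
  by rewrite leqNgt hk.
have hi : (i < (i + j).+1)%N by lia.
have := Qgh (i + j)%N; rewrite coefM (bigD1 (Ordinal hi)) //= addKn => H.
have Qij : Q (g`_i * h`_j).
  rewrite -[X in Q X](addrK (\sum_(k < (i + j).+1 | k != Ordinal hi) g`_k * h`_(i + j - k))).
  apply: (submodB hR (prime_submod hQ) H); apply: (submod_sum _ (prime_submod hQ)) => k.
  rewrite -val_eqE /= => nk; have [hk|hk] := ltnP k i.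
    by apply: (prime_mr hQ) => //; exact: lti.
  apply: (prime_ml hQ) => //; apply: ltj; have := ltn_ord k; lia.
by case: (prime_or hQ (Rg i) (Rh j) Qij).
Qed.

Lemma SsetM g h : Sset D star g -> Sset D star h -> Sset D star (g * h).
Proof.
move=> [Rg ng] [Rh nh]; have hR := polyD_subring; split.
  move=> i; rewrite coefM; apply: (submod_sum _ (subring_submod hR)) => j _.
  exact: subringM.
move=> Q hQ hgh; case: (prime_poly_mul hR (proj1 hQ) Rg Rh hgh) => h';
  by [apply: (ng Q) | apply: (nh Q)].
Qed.

Lemma Sset1 : Sset D star 1.
Proof.
have hR := polyD_subring; split.
  by move=> i; rewrite coefC; case: ifP => _; [exact: subring1 | exact: subring0].
by move=> Q [hQ _] /(_ 0%N); rewrite coefC eqxx; exact: prime_n1 hQ.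
Qed.

Lemma starX1_of_Sset E f : Sset D star f ->
  (forall i, E f`_i) -> starX D star E 1.
Proof. by move=> Sf hE; exists f; split=> // i; rewrite mul1r. Qed.

Lemma starX_unit_law : unit_law (polyD D) (starX D star).
Proof.
have hR := polyD_subring.
split.
- by move=> s _ hs x [g [Sg hg]]; exists g; split=> // i; apply: hs.
- exists 1; split; first exact: Sset1.
  by move=> i; rewrite mul1r coefC; case: ifP => _; [exact: subring1 | exact: subring0].
(* The multiplier [g] brings 1 into the module and [h] brings [f] into D[X]; their product brings
   [f] into the module. *)
move=> s _ hs [g [Sg hg]] f [h [Sh hh]]; exists (h * g); split; first exact: SsetM.
move=> i; rewrite coefM mulr_sumr; apply: (submod_sum _ (fgen_submod _ hR)) => j _.
by rewrite mulrA; apply: (submodM (fgen_submod _ hR)) => //; rewrite -[g`_ _]mul1r.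
Qed.

(** A prime in [Theta] cannot contain all coefficients of an element of [Sset]; any other prime
    contains those of some such [g], and they generate an ideal whose closure contains 1. *)
Lemma admissible_polyD Q : admissible (polyD D) (starX D star) Q <->
  prime (polyD D) Q /\ admissible D star (con Q).
Proof.
rewrite -ThetaE; split=> [[hQ h]|hT]; last first.
  split; first by case: hT.
  right=> -[s [_ [sQ [g [[_ Sg] hg]]]]].
  by apply: (Sg Q hT) => i; apply: sQ; rewrite -[g`_i]mul1r.
apply: contrapT => nT; have [g [Sg Qg nzg]] := Sset_of_not_Theta hQ nT.
case: h => [h|]; first by case: nzg => x [/(nthP 0) [i _ <-]]; rewrite (h _ (Qg i)) eqxx.
apply; exists g; split=> //; split.
  by apply: fgen_sub => //; exact: prime_submod hQ.
apply: (starX1_of_Sset Sg) => i; exact: fgen_nth polyD_subring.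
Qed.

(** For [Q] in [Theta], an element of D[X] in the closure is multiplied into [Q] by all coefficients
    of some [g], one of which is outside [Q]. *)
Lemma qprime_starX Q : qprime (polyD D) (starX D star) Q <->
  (exists x, Q x /\ x != 0) /\ admissible (polyD D) (starX D star) Q.
Proof.
have tE : admissible (polyD D) (starX D star) Q <-> Theta D star Q.
  by rewrite admissible_polyD ThetaE.
rewrite tE; split=> [[[hI [nz [hst _]]] hQ]|[nz hT]].
  split=> //; apply: contrapT => nT; have [g [Sg Qg _]] := Sset_of_not_Theta hQ nT.
  apply: (prime_n1 hQ); apply: hst; split; first exact: starX1_of_Sset Sg Qg.
  exact: subring1 polyD_subring.
have hQ : prime (polyD D) Q by case: hT.
split=> //; split; first by case: hQ.
split=> //; split=> y; last first.
  move=> Qy; split; last exact: prime_sub hQ _ Qy.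
  exists 1; split; first exact: Sset1.
  by move=> i; rewrite coefC; case: ifP => _; rewrite ?mulr1 ?mulr0 //; exact: prime0 hQ.
move=> [[g [[Rg ng] hg]] Ry].
have /existsNP [i ni] := ng Q hT.
by case: (prime_or hQ Ry (Rg i) (hg i)).
Qed.

End PolynomialExtension.

(** * Quasi-maximal ideals, [tilde]-valuation overrings and linked overrings *)

Section Tilde.
Variables (K : fieldType) (D : K -> Prop) (star : (K -> Prop) -> (K -> Prop)).
Hypotheses (hD : subring D) (hq : quotient_field_of D) (hs : semistar D star).
Implicit Types (I J M P Q T V : K -> Prop).

Let star_mono s t : fgnz s -> fgnz t -> (forall x, x \in s -> fgen D t x) ->
  subset (star (fgen D s)) (star (fgen D t)).
Proof.
move=> ns nt h; case: (hs) => _ [_ [hmon _]].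
apply: hmon; try exact: fgen_Fbar; apply: fgen_sub; first exact: fgen_submod.
by move=> i hi; apply/h/mem_nth.
Qed.

Let fgen_star s : fgnz s -> subset (fgen D s) (star (fgen D s)).
Proof. by move=> ns; case: (hs) => _ [_ [_ [hext _]]]; apply: hext; exact: fgen_Fbar. Qed.

Let star_submod s : fgnz s -> submod D (star (fgen D s)).
Proof. by move=> ns; case: (hs) => hF _; case: (hF _ (fgen_Fbar hD ns)). Qed.

Lemma fgnz_catl (s t : seq K) : fgnz s -> fgnz (s ++ t).
Proof. by move=> [x [xs x0]]; exists x; rewrite mem_cat xs. Qed.

Lemma fgen_sub_ideal (s : seq K) I : ideal D I -> (forall x, x \in s -> I x) -> subset (fgen D s) I.
Proof. by move=> [_ hI] h; apply: fgen_sub hI _ => i hi; apply/h/mem_nth. Qed.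

(** Concatenating generators shows that the union defining [star_f] is directed. *)
Lemma star_f_union2 I s t : ideal D I -> fgnz s -> fgnz t ->
  subset (fgen D s) I -> subset (fgen D t) I ->
  [/\ fgnz (s ++ t), subset (fgen D (s ++ t)) I,
      subset (star (fgen D s)) (star (fgen D (s ++ t)))
    & subset (star (fgen D t)) (star (fgen D (s ++ t)))].
Proof.
move=> hI ns nt sI tI; have nst := fgnz_catl t ns; split=> //.
- apply: fgen_sub_ideal => // x; rewrite mem_cat => /orP [xs|xt].
    by apply: sI; exact: fgen_mem.
  by apply: tI; exact: fgen_mem.
- by apply: star_mono => // x xs; apply: fgen_mem => //; rewrite mem_cat xs.
- by apply: star_mono => // x xs; apply: fgen_mem => //; rewrite mem_cat xs orbT.
Qed.

Lemma sub_star_f I : ideal D I -> (exists x, I x /\ x != 0) -> subset I (star_f D star I).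
Proof.
(* The generator [y] keeps the list nonzero when [x] is 0. *)
move=> hI [y [Iy y0]] x Ix; exists [:: x; y].
have nxy : fgnz [:: x; y] by exists y; rewrite !inE eqxx orbT.
split=> //; split; last by apply: fgen_star => //; apply: fgen_mem => //; rewrite mem_head.
by apply: fgen_sub_ideal => // z; rewrite !inE => /orP [] /eqP ->.
Qed.

Lemma star_f_ideal I : ideal D I -> (exists x, I x /\ x != 0) ->
  ideal D (fun x => star_f D star I x /\ D x).
Proof.
move=> hI nz; split; first by move=> x [].
split.
  by split; [apply: sub_star_f => //; case: hI => _ /submod0 | exact: subring0].
split=> [x y [[s [ns [sI hx]]] Dx] [[t [nt [tI hy]]] Dy]|d x Dd [[s [ns [sI hx]]] Dx]].
  split; last exact: subringD.
  have [nst stI h1 h2] := star_f_union2 hI ns nt sI tI.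
  exists (s ++ t); split=> //; split=> //.
  by apply: (submodD (star_submod nst)); [exact: h1 | exact: h2].
split; last exact: subringM.
by exists s; split=> //; split=> //; exact: submodM (star_submod ns) _ _.
Qed.

Lemma star_f_gather I (s : seq K) : ideal D I -> (exists x, I x /\ x != 0) ->
  (forall x, x \in s -> star_f D star I x) ->
  exists t, [/\ fgnz t, subset (fgen D t) I & forall x, x \in s -> star (fgen D t) x].
Proof.
move=> hI [y [Iy y0]]; elim: s => [|x s IH] h.
  exists [:: y]; split=> //; first by exists y; rewrite mem_head.
  by apply: fgen_sub_ideal => // z; rewrite inE => /eqP ->.
have [|t [nt tI ht]] := IH; first by move=> z zs; apply: h; rewrite inE zs orbT.
have [u [nu [uI hu]]] := h x (mem_head _ _).
have [nut utI h1 h2] := star_f_union2 hI nu nt uI tI.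
exists (u ++ t); split=> // z; rewrite inE => /orP [/eqP ->|zs]; first exact: h1.
by apply/h2/ht.
Qed.

(** The finitely many generators witnessing 1 lie in a single closure by [star_f_gather], and [star]
    is idempotent. *)
Lemma star_f_idem I : ideal D I -> (exists x, I x /\ x != 0) ->
  star_f D star (fun x => star_f D star I x /\ D x) 1 -> star_f D star I 1.
Proof.
move=> hI nz [s [ns [sI h1]]].
have [|t [nt tI ht]] := @star_f_gather I s hI nz.
  by move=> x xs; case: (sI x (fgen_mem hD xs)).
exists t; split=> //; split=> //.
apply: (semistar_sub_star hD hs ns (fgen_Fbar hD nt)) h1.
by apply: fgen_sub; [exact: star_submod | move=> i hi; apply/ht/mem_nth].
Qed.

(** Zorn's lemma is applied to the ideals above [P] whose [star_f] misses 1. By [star_f_idem], the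
    trace on [D] of the closure of a maximal one is again in this family, so it is a quasi-ideal. *)
Lemma qmax_above P : ideal D P -> (exists x, P x /\ x != 0) -> ~ star_f D star P 1 ->
  exists M, qmax D (star_f D star) M /\ subset P M.
Proof.
move=> hP [x0 [Px0 nx0]] nP.
pose ok I := [/\ ideal D I, subset P I & ~ star_f D star I 1].
have okP : ok P by split.
pose le (I J : {I | ok I}) := subset (sval I) (sval J).
case: (@Zorn_preorder _ (exist _ _ okP) le).
- by move=> t x.
- by move=> r s t h1 h2 x /h1; exact: h2.
- move=> A tot [t0 At0].
  pose U x := exists2 t, A t & (sval t) x.
  have okt (t : {I | ok I}) : ok (sval t) := svalP t.
  have dir s t : A s -> A t -> exists2 u, A u & le s u /\ le t u.
    by move=> As At; case: (tot s t As At) => h; [exists t | exists s] => //; split=> // x.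
  (* Finitely many elements of the union lie in one member of the chain, so a finite witness for 1
     would already occur there. *)
  have gather (s : seq K) : (forall x, x \in s -> U x) -> exists2 t, A t & forall x, x \in s -> sval t x.
    elim: s => [|x s IH] h; first by exists t0.
    have [t At ht] := IH (fun z zs => h z (mem_behead (s := x :: s) zs)).
    have [u Au ux] := h x (mem_head _ _).
    have [v Av [tv uv]] := dir t u At Au.
    by exists v => // z; rewrite inE => /orP [/eqP -> |/ht /tv //]; exact: uv.
  have okU : ok U.
    split.
    + split; first by move=> x [t _]; case: (okt t) => [[h _] _ _]; exact: h.
      split; first by exists t0 => //; case: (okt t0) => [[_ /submod0]].
      split=> [x y [s As sx] [t At ty]|d x Dd [t At tx]].
        have [u Au [su tu]] := dir s t As At; exists u => //.
        case: (okt u) => [[_ hu] _ _]; apply: (submodD hu); [exact: su | exact: tu].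
      by exists t => //; case: (okt t) => [[_ ht] _ _]; exact: submodM ht _ _.
    + by move=> x Px; exists t0 => //; case: (okt t0) => _ h _; exact: h.
    move=> [s [ns [sU h1]]]; have [|t At ht] := gather s.
      by move=> x xs; apply: sU; exact: fgen_mem.
    case: (okt t) => hI _; apply; exists s; split=> //; split=> //.
    exact: fgen_sub_ideal.
  by exists (exist _ _ okU) => t At x tx /=; exists t.
move=> [M okM] maxM; have [hM sPM nM] := okM.
have nzM : exists x, M x /\ x != 0 by exists x0; split=> //; exact: sPM.
have big I : ideal D I -> subset M I -> ~ star_f D star I 1 -> subset I M.
  move=> hI sMI nI; have okI : ok I by split=> // x /sPM /sMI.
  exact: (maxM (exist _ _ okI)).
have sMs : subset M (fun x => star_f D star M x /\ D x).
  by move=> x Mx; split; [exact: sub_star_f | case: hM => h _; exact: h].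
exists M; split=> //; split.
  split=> //; split=> //; split=> //.
  by apply: big => //; [exact: star_f_ideal | move/(star_f_idem hM nzM)].
split; first by move=> M1; apply: nM; exact: sub_star_f.
move=> I [hI [nzI [hqI _]]] nI1 sMI; apply: big => // h1; apply: nI1.
by apply: hqI; split=> //; exact: subring1.
Qed.

Lemma qmax_avoids M s : qmax D (star_f D star) M -> fgnz s ->
  star (fgen D s) 1 -> exists2 x, x \in s & ~ M x.
Proof.
move=> [[hM [_ [hqM _]]] [nM _]] ns h1; apply: contrapT => h; apply: nM.
apply: hqM; split; last exact: subring1.
exists s; split=> //; split=> //; apply: fgen_sub_ideal => // x xs.
by apply: contrapT => nMx; apply: h; exists x.
Qed.

(** Each quasi-maximal [M] misses some generator [x], and 1 is the fraction [x / x]. *)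
Lemma tilde_of_unit (s : seq K) P : fgnz s -> (forall x, x \in s -> D x /\ P x) ->
  star (fgen D s) 1 -> tilde D star P 1.
Proof.
move=> ns sP h1 M hM; have [x xs nx] := qmax_avoids hM ns h1.
by exists x, x; have [Dx Px] := sP x xs; rewrite mul1r.
Qed.

(** If [P] is admissible and nonzero, a quasi-maximal [M] lies above it; a denominator outside [M]
    is outside [P] and cancels by primality. *)
Lemma qprime_tilde P : qprime D (tilde D star) P <->
  (exists x, P x /\ x != 0) /\ admissible D star P.
Proof.
split=> [[[hI [nz [hqP _]]] hP]|[nz [hP h]]].
  split=> //; split=> //; right=> -[s [ns [sP h1]]]; apply: (prime_n1 hP).
  apply: hqP; split; last exact: subring1.
  apply: (tilde_of_unit ns) h1 => x xs.
  have Px := sP x (fgen_mem hD xs); split=> //; exact: prime_sub hP _ Px.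
have hI : ideal D P by case: hP.
split=> //; split=> //; split=> //; split=> [y [hy Dy]|y Py].
  case: h => [h|h]; first by case: nz => x [/h ->]; rewrite eqxx.
  have [M [hM sPM]] := qmax_above hI nz h.
  have [e [s [Pe [Ds [nMs es]]]]] := hy M hM.
  by rewrite -es in Pe; case: (prime_or hP Dy Ds Pe) => // /sPM.
split; last exact: prime_sub hP _ Py.
move=> M [_ [nM _]]; exists y, 1; rewrite mulr1; split=> //; split=> //.
exact: subring1.
Qed.

Definition center V : K -> Prop := fun x => D x /\ maxid V x.

Lemma center_prime V : subset D V -> valring V -> prime D (center V).
Proof. by move=> sDV vV; exact: prime_contr sDV (maxid_prime vV). Qed.

Lemma prime_contr_zero T Q : overring D T -> prime T Q ->
  (forall x, D x -> Q x -> x = 0) -> forall x, Q x -> x = 0.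
Proof.
move=> [hT sDT] hQ h x Qx; have [a [b [Da [Db [b0 ex]]]]] := hq x.
have a0 : a = 0.
  apply: h => //; have -> : a = b * x by rewrite ex mulrCA divff // mulr1.
  by apply: (prime_ml hQ) => //; exact: sDT.
by rewrite ex a0 mul0r.
Qed.

Lemma fgen_unit T (s : seq K) x : subring T -> subset D T -> (forall y, y \in s -> T y) ->
  x \in s -> x != 0 -> T x^-1 -> seteq (fgen T s) T.
Proof.
move=> hT sDT sT xs x0 ix; split.
  by apply: fgen_sub => [|i hi]; [exact: subring_submod | apply/sT/mem_nth].
move=> z Tz; have -> : z = z * x^-1 * x by rewrite divfK.
apply: (submodM (fgen_submod _ hT)); [exact: subringM | exact: fgen_mem].
Qed.

(** A module F inside the centre with 1 in F^star would give 1 in F V, inside the maximal ideal.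
    Conversely, denominators outside a quasi-maximal ideal above the centre are units of [V]. *)
Lemma tilde_valE V : tilde_val D star V <->
  valuation_overring D V /\ admissible D star (center V).
Proof.
split=> [[[[hV sDV] vV] ht]|[[[hV sDV] vV] [hc h]]].
  have vrV : valring V by [].
  split=> //; split; first exact: center_prime.
  right=> -[s [ns [sP h1]]].
  have sc x : x \in s -> center V x by move=> xs; apply: sP; exact: fgen_mem.
  have : fgen V s 1.
    apply: (ht s ns); apply: (tilde_of_unit ns) h1 => x xs.
    by split; [case: (sc x xs) | exact: fgen_mem].
  move/(@fgen_sub _ V s (maxid V) (prime_submod (maxid_prime vrV))) => h.
  apply: (prime_n1 (maxid_prime vrV)); apply: h => i hi.
  by case: (sc _ (mem_nth 0 hi)).
have vrV : valring V by [].
split=> // s ns y hy.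
(* A zero centre forces [V] to be all of [K], where F V is [K] as well. *)
have [z0|nz] := pselect (forall x, center V x -> x = 0).
  have mz : forall x, maxid V x -> x = 0.
    by apply: (@prime_contr_zero V (maxid V)) => //; [exact: maxid_prime | move=> x Dx mx; exact: z0].
  case: ns => x [xs x0].
  have allV w : V w.
    have [->|w0] := eqVneq w 0; first exact: subring0.
    apply: contrapT => nVw; have [//|Vi] := vV w w0.
    have /eqP : w^-1 = 0 by apply: mz; split=> //; rewrite invrK.
    by rewrite invr_eq0 (negPf w0).
  have -> : y = y * x^-1 * x by rewrite divfK.
  by apply: (submodM (fgen_submod _ hV)) => //; exact: fgen_mem.
have /existsNP [x] := nz; move/not_implyP => [cx /eqP x0].
case: h => [/(_ x cx)/eqP h|h]; first by rewrite (negPf x0) in h.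
have [||M [hM sPM]] := qmax_above _ _ h.
- by case: hc.
- by exists x.
have [e [t [he [Dt [nMt et]]]]] := hy M hM.
have nmt : ~ maxid V t by move=> mt; apply: nMt; apply: sPM.
have t0 : t != 0 by apply/eqP => t0; apply: nmt; rewrite t0; exact: prime0 (maxid_prime vrV).
have it : V t^-1 by apply: maxid_inv => //; exact: sDV.
have -> : y = t^-1 * e by rewrite -et mulrCA mulVf // mulr1.
by apply: (submodM (fgen_submod _ hV)) => //; exact: fgen_subring_le he.
Qed.

Lemma star_unit_eq s : fgnz s -> subset (fgen D s) D -> star (fgen D s) 1 ->
  seteq (star (fgen D s)) (star D).
Proof.
move=> ns sD h1; have [hm _ hu] := semistar_unit_law hD hs.
by split; [exact: hm | exact: hu].
Qed.

(** Linkedness makes a finitely generated ideal with 1 in its closure extend to [T], so it cannot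
    lie in [Q]. *)
Lemma linked_prime T Q : linked D star T -> prime T Q ->
  admissible D star (fun x => D x /\ Q x).
Proof.
move=> [[hT sDT] hl] hQ; split; first exact: prime_contr sDT hQ.
right=> -[s [ns [sP h1]]]; apply: (prime_n1 hQ).
have sQ x : x \in s -> D x /\ Q x by move=> xs; apply: sP; exact: fgen_mem.
have sD i : (i < size s)%N -> D s`_i by move=> hi; case: (sQ _ (mem_nth 0 hi)).
have sFD : subset (fgen D s) D by move=> x /sP [].
have [_ h] := hl s ns sD (star_unit_eq ns sFD h1).
apply: (fgen_sub (prime_submod hQ)) (h 1 (subring1 hT)) => i hi.
by case: (sQ _ (mem_nth 0 hi)).
Qed.

(** By admissibility of the centre, some generator lies outside it and is a unit of [V]. *)
Lemma tilde_val_linked V : tilde_val D star V -> linked D star V.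
Proof.
move/tilde_valE => [[[hV sDV] vV] [hc h]]; have vrV : valring V by [].
split=> // s ns sD hst.
have sDs x : x \in s -> D x by move=> /(nthP 0) [i hi <-]; exact: sD.
have [x xs nx] : exists2 x, x \in s & x != 0 /\ ~ maxid V x.
  apply: contrapT => hno.
  have sm x : x \in s -> center V x.
    move=> xs; split; first exact: sDs.
    apply: contrapT => nx; apply: hno; exists x => //; split=> //.
    by apply/eqP => x0; apply: nx; rewrite x0; exact: prime0 (maxid_prime vrV).
  case: h => [h|]; first by case: ns => x [/sm/h ->]; rewrite eqxx.
  apply; exists s; split=> //; split.
    by apply: fgen_sub_ideal => //; case: hc.
  by apply: (proj2 hst); have [_ h1 _] := semistar_unit_law hD hs.
have [x0 nmx] := nx.
apply: (fgen_unit hV sDV _ xs x0); first by move=> y /sDs; exact: sDV.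
by apply: maxid_inv => //; apply/sDV/sDs.
Qed.

End Tilde.

(** * Chains with a budget of invisible steps *)

Section WeakChains.
Variable K : fieldType.
Implicit Types (D T P Q : K -> Prop).

(* [s] continues a chain of primes of [T] starting at [P]; at most [c] of its
   steps are invisible after contraction to [D]. *)
Fixpoint wchain D T P (s : seq (K -> Prop)) (c : nat) : Prop :=
  prime T P /\ if s is Q :: s' then subset P Q /\
    ((exists x, [/\ D x, Q x & ~ P x]) /\ wchain D T Q s' c \/
     [/\ exists x, Q x /\ ~ P x, (0 < c)%N & wchain D T Q s' c.-1]) else True.

Lemma wchain_prime D T P s c : wchain D T P s c -> prime T P.
Proof. by case: s => [|Q s] []. Qed.

(** Every step is charged to the budget, whether visible or not. *)
Lemma pchain_wchain D T P s : pchain T P s -> wchain D T P s (size s).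
Proof.
elim: s P => [|Q s IH] P [hP] // [[sPQ nQ] /IH h].
by split=> //; split=> //; right; split.
Qed.

Lemma wchain_contr D T P s : subring D -> subset D T -> wchain D T P s 0 ->
  pchain D (fun x => D x /\ P x) [seq (fun x => D x /\ Q x) | Q <- s].
Proof.
move=> hD sDT; elim: s P => [|Q s IH] P [hP] //; first by split=> //; exact: prime_contr sDT hP.
move=> [sPQ [[[x [Dx Qx nPx]] hc]|[_ //]]].
split; first exact: prime_contr sDT hP.
split; last exact: IH.
by split=> [y [Dy /sPQ]|] //; exists x; split=> // -[].
Qed.

Lemma wchain_last D T P s c : wchain D T P s c -> prime T (last P s).
Proof.
elim: s P c => [|Q s IH] P c [hP] // [_ [[_ /IH]|[_ _ /IH]]] //.
Qed.

End WeakChains.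

(** * Lifting chains along evaluation maps *)

Section Evaluation.
Variable K : fieldType.
Local Notation KX := {fraction {poly K}}.
Local Notation tf := (@tofrac {poly K}).
Implicit Types (D T P Q : K -> Prop).

(** The inverse image of [P] under evaluation at [y] from T[X] to [T]. *)
Definition evp T (y : K) P : KX -> Prop :=
  fun z => exists p : {poly K}, [/\ forall i, T p`_i, z = tf p & P p.[y]].

Lemma horner_subring T (p : {poly K}) y : subring T -> T y -> (forall i, T p`_i) -> T p.[y].
Proof.
move=> hT Ty hp; rewrite horner_coef; apply: (submod_sum _ (subring_submod hT)) => i _.
by apply: subringM => //; exact: subringX.
Qed.

Lemma evp_tf T y P (p : {poly K}) : evp T y P (tf p) <-> (forall i, T p`_i) /\ P p.[y].
Proof.
by split=> [[q [hq /tf_inj -> Pq]]|[hp Pp]] //; exists p.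
Qed.

Lemma evp_const T y P a : subring T -> subset P T -> (evp T y P (tf a%:P) <-> P a).
Proof.
move=> hT sPT; rewrite evp_tf hornerC; split=> [[]|Pa] //; split=> // i.
by rewrite coefC; case: ifP => _; [exact: sPT | exact: subring0].
Qed.

Lemma evp_prime T y P : subring T -> T y -> prime T P -> prime (polyD T) (evp T y P).
Proof.
move=> hT Ty hP; split.
  split; first by move=> _ [p [hp -> _]]; exists p.
  split.
    rewrite -(rmorph0 tf) evp_tf horner0; split; last exact: prime0 hP.
    by move=> i; rewrite coef0; exact: subring0.
  split=> [_ _ [p [hp -> Pp]] [q [hq -> Pq]]|_ _ [p [hp ->]] [q [hq -> Pq]]].
    rewrite -rmorphD evp_tf hornerD; split; last exact: prime_D hP _ _.
    by move=> i; rewrite coefD; exact: subringD.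
  rewrite -rmorphM evp_tf hornerM; split.
    move=> i; apply: polyD_coef; rewrite rmorphM.
    by apply: subringM; [exact: polyD_subring | exists p | exists q].
  by apply: (prime_ml hP) => //; exact: horner_subring.
split.
  by rewrite -(rmorph1 tf) evp_tf hornerC => -[_]; exact: prime_n1 hP.
move=> _ _ [p [hp ->]] [q [hq ->]]; rewrite -rmorphM !evp_tf hornerM => -[_].
case/(prime_or hP (horner_subring hT Ty hp) (horner_subring hT Ty hq)) => h; by [left | right].
Qed.

Lemma evp_sub T y P Q : subset P Q -> subset (evp T y P) (evp T y Q).
Proof. by move=> sPQ _ [p [hp -> Pp]]; exists p; split=> //; exact: sPQ. Qed.

(** Constants evaluate to themselves, so each old witness of a step still serves. *)
Lemma wchain_evp D T y P s c : subring D -> subring T -> T y -> wchain D T P s c ->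
  wchain (polyD D) (polyD T) (evp T y P) (map (evp T y) s) c.
Proof.
move=> hD hT Ty; elim: s P c => [|Q s IH] P c [hP]; first by split=> //; exact: evp_prime.
move=> [sPQ h]; split; first exact: evp_prime.
split; first exact: evp_sub.
have sPT := prime_sub hP.
case: h => [[[x [Dx Qx nPx]] hc]|[[x [Qx nPx]] c0 hc]].
  have sQT := prime_sub (wchain_prime hc).
  left; split; last exact: IH.
  by exists (tf x%:P); split; [apply/polyD_const | apply/evp_const | move/evp_const => h; apply/nPx/h].
have sQT := prime_sub (wchain_prime hc).
right; split=> //; last exact: IH.
by exists (tf x%:P); split; [apply/evp_const | move/evp_const => h; apply/nPx/h].
Qed.

(* Evaluating at a witness [y] of the first step not seen by [D], the
   variable makes that step visible in [D[X]]. *)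
Lemma wchain_evp_pred D T P s c : subring D -> subring T -> wchain D T P s c ->
  exists2 y, T y & wchain (polyD D) (polyD T) (evp T y P) (map (evp T y) s) c.-1.
Proof.
move=> hD hT; elim: s P => [|Q s IH] P [hP].
  by move=> _; exists 0; [exact: subring0 | split=> //; exact: (evp_prime hT (subring0 hT))].
move=> [sPQ [[[x [Dx Qx nPx]] hc]|[[x [Qx nPx]] c0 hc]]]; have hQ := wchain_prime hc.
  have [y Ty hy] := IH Q hc; exists y => //; split; first exact: evp_prime.
  split; first exact: evp_sub.
  left; split=> //.
  have [sPT sQT] := (prime_sub hP, prime_sub hQ).
  by exists (tf x%:P); split; [apply/polyD_const | apply/evp_const | move/evp_const => h; apply/nPx/h].
have Tx := prime_sub hQ Qx; exists x => //; split; first exact: evp_prime.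
split; first exact: evp_sub.
left; split; last exact: wchain_evp.
have cX R : subring R -> forall i, R ('X : {poly K})`_i.
  by move=> hR i; rewrite coefX; case: (i == _); [exact: subring1 | exact: subring0].
exists (tf 'X); split.
- by exists 'X; split=> //; exact: cX.
- by apply/evp_tf; rewrite hornerX; split=> //; exact: cX.
by move=> /evp_tf; rewrite hornerX => -[].
Qed.

(** Writing [y] as [a / b] over [D], the polynomial bX - a vanishes at [y]. *)
Lemma evp_nonzero D T y P : subring D -> subring T -> subset D T ->
  quotient_field_of D -> prime T P -> T y ->
  exists z, [/\ polyD D z, evp T y P z & z != 0].
Proof.
move=> hD hT sDT hq hP Ty; have [a [b [Da [Db [b0 ey]]]]] := hq y.
have hc i : D (b *: 'X - a%:P)`_i.
  rewrite coefB coefZ coefX coefC; apply: subringB => //.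
    by case: (i == _); rewrite ?mulr1 ?mulr0 //; exact: subring0.
  by case: ifP => // _; exact: subring0.
exists (tf (b *: 'X - a%:P)); split.
- by exists (b *: 'X - a%:P).
- apply/evp_tf; split; first by move=> i; apply: sDT.
  rewrite hornerD hornerN hornerZ hornerX hornerC ey mulrCA divff // mulr1 subrr.
  exact: prime0 hP.
rewrite tofrac_eq0; apply/eqP => /(congr1 (fun p : {poly K} => p`_1)).
by rewrite coefB coefZ coefX coefC coef0 /= mulr1 subr0 => /eqP; rewrite (negPf b0).
Qed.

(** Prefixing (0) adds a step visible by [evp_nonzero], while [wchain_evp_pred] lowers the budget by
    one. *)
Lemma wchain_step D T s c : subring D -> subring T -> subset D T ->
  quotient_field_of D -> wchain D T (fun x => x = 0) s c ->
  exists2 y, T y & wchain (polyD D) (polyD T) (fun x => x = 0)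
    (map (evp T y) ((fun x => x = 0) :: s)) c.-1.
Proof.
move=> hD hT sDT hq hc; have [y Ty hy] := wchain_evp_pred hD hT hc.
exists y => //; split; first exact: (prime_zero (polyD_subring hT)).
split; first by move=> _ ->; exact: prime0 (evp_prime hT Ty (wchain_prime hc)).
left; split=> //.
have [z [Dz Pz z0]] := evp_nonzero hD hT sDT hq (wchain_prime hc) Ty.
by exists z; split=> //; apply/eqP.
Qed.

End Evaluation.

(** * Chains of quasi-primes as chains ending in an admissible prime *)

Section StarChain.
Variables (K : fieldType) (R : K -> Prop) (st st' : (K -> Prop) -> (K -> Prop)).
Hypothesis hR : subring R.
Hypothesis qprimeE : forall P, qprime R st P <->
  (exists x, P x /\ x != 0) /\ admissible R st' P.

(** Admissibility passes to smaller primes, so only the last one is tested. Two operations occur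
    because for no variables quasi-primes refer to [tilde] and admissibility to [star]. *)
Lemma star_chainE k : star_chain R st k <-> exists s, [/\ size s = k,
  pchain R (fun x => x = 0) s & admissible R st' (last (fun x => x = 0) s)].
Proof.
split=> [[s [es [hqp hlt]]]|[s [es hc hadm]]].
  exists s; split=> //.
    apply/pchainE; rewrite es; split=> -[|i] hi /=.
    - exact: prime_zero.
    - by case: (hqp i hi).
    - case/qprimeE: (hqp 0%N hi) => [[x [Px x0]] [hP _]].
      split; first by move=> _ ->; exact: prime0 hP.
      by exists x; split=> //; apply/eqP.
    exact: hlt.
  case: (posnP k) => k0.
    by move: es; rewrite k0 => /size0nil ->; split; [exact: prime_zero | left].
  case: s es hqp hlt => [|P s] es hqp hlt; first by rewrite -es in k0.
  have -> : last (fun x => x = 0) (P :: s) = nth (@bot K) (P :: s) k.-1.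
    by rewrite -es -nth_last /=; apply: set_nth_default.
  have hk : (k.-1 < k)%N by rewrite prednK.
  by case/qprimeE: (hqp _ hk).
exists s; split=> //.
have H := hc; case/pchainE: H => hpr hlt; rewrite es in hpr hlt.
split=> i hi; last exact: (hlt i.+1).
apply/qprimeE; split.
  have [_ [x [Px nx]]] := hlt i hi.
  exists x; split=> //; apply/eqP => x0; apply: nx.
  by rewrite x0; apply: prime0 (hpr i _); exact: ltnW.
have sub : subset (nth (@bot K) s i) (last (fun x => x = 0) s).
  rewrite -es in hi; move: hc; move: (fun x : K => x = 0) => P.
  elim: s i P hi {es hadm hpr hlt} => // Q s IH [|i] P hi /= [_ [_ hc]].
    exact: pchain_sub_last hc.
  exact: IH.
by apply: admissible_sub sub hadm; exact: (hpr i.+1).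
Qed.

End StarChain.

(** * Comparison of the dimensions *)

Section Main.
Variables (K : fieldType) (D : K -> Prop) (star : (K -> Prop) -> (K -> Prop)).
Hypotheses (hD : subring D) (hq : quotient_field_of D) (hs : semistar D star).

Local Notation ext_dom r := (sdom (ext r (@Setting K D star))).
Local Notation ext_star r := (sop (ext r (@Setting K D star))).
Local Notation ext_fld r := (sfld (ext r (@Setting K D star))).
Local Notation starn_chain r k :=
  (star_chain (sdom (starn D star r)) (sop (starn D star r)) k).

Lemma ext_subring r : subring (ext_dom r).
Proof. by elim: r => [|r IH] //=; exact: polyD_subring. Qed.

Lemma ext_quotient_field r : quotient_field_of (ext_dom r).
Proof. by elim: r => [|r IH] //=; apply: polyD_quotient_field => //; exact: ext_subring. Qed.

Lemma ext_unit_law r : unit_law (ext_dom r) (ext_star r).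
Proof.
case: r => [|r] /=; first exact: semistar_unit_law.
by apply: starX_unit_law; exact: ext_subring.
Qed.

Lemma starn_chainE r k : starn_chain r k <->
  exists s : seq (ext_fld r -> Prop), [/\ size s = k,
    pchain (ext_dom r) (fun x => x = 0) s
    & admissible (ext_dom r) (ext_star r) (last (fun x => x = 0) s)].
Proof.
case: r => [|r]; first by apply: star_chainE => // P; exact: qprime_tilde.
apply: star_chainE; first exact: (ext_subring r.+1).
by move=> P; apply: qprime_starX; [exact: ext_subring | exact: ext_unit_law].
Qed.

(** Each variable removed costs at most one prime by [krull_chain_ctr], and the centre of the
    restricted ring is the contraction of the old centre. *)
Lemma valuation_descent r (W : ext_fld r -> Prop) k : valring W ->
  subset (ext_dom r) W -> admissible (ext_dom r) (ext_star r) (center (ext_dom r) W) ->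
  krull_chain W k ->
  exists V k', [/\ tilde_val D star V, (k <= k' + r)%N & krull_chain V k'].
Proof.
elim: r W k => [|r IH] W k vW sDW adm hW.
  exists W, k; rewrite addn0; split=> //; apply/tilde_valE => //; split=> //.
  by case: vW.
pose tfr : {rmorphism {poly ext_fld r} -> _} := @tofrac {poly ext_fld r}.
have tf_eq0 p : (tfr p == 0) = (p == 0) by exact: tofrac_eq0.
have tf_div z : exists p q, q != 0 /\ z = tfr p / tfr q by exact: fraction_div.
have [k1 [hk1 hc1]] := krull_chain_ctr tf_eq0 tf_div vW hW.
have hDr := ext_subring r.
have [|||V [k' [hV hk' hc']]] := IH (ctr tfr W) k1 _ _ _ hc1.
- exact: ctr_valring.
- by move=> x Dx; apply: sDW; apply/polyD_const.
- case/(admissible_polyD hDr (ext_unit_law r)): adm => _.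
  congr (admissible _ _ _); apply/predeqP => a; rewrite /con /center.
  have hE : maxid (ctr tfr W) a <-> maxid W (tfr a%:P) := ctr_maxid tfr W a.
  split=> [[Da [_ /hE h]]|[Da /hE h]]; first by split.
  by split=> //; split=> //; apply/polyD_const.
by exists V, k'; split=> //; lia.
Qed.

Lemma starn_chain_valuation r k : starn_chain r k ->
  exists V k', [/\ tilde_val D star V, (k <= k' + r)%N & krull_chain V k'].
Proof.
case/starn_chainE => s [es hc adm].
have [W [P [s' [vW sW es' hc' hl]]]] := val_chain (ext_subring r) hc.
apply: (@valuation_descent r W k) => //.
  rewrite (_ : center _ _ = last (fun x => x = 0) s) //.
  apply/predeqP => x; split=> [[Dx mx]|lx]; first by apply/hl.
  have Dx : ext_dom r x by exact: prime_sub (pchain_last hc) _ lx.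
  by split=> //; apply/hl.
by apply/krull_chainE; exists P, s'; rewrite es' es.
Qed.

(** The budget starts at [n.-1], since the first step is visible in [D], and each variable lowers it
    by one while lengthening the chain by one. The last prime keeps its contraction to [D], hence
    its admissibility. *)
Lemma wchain_ext V n r : tilde_val D star V -> krull_chain V n -> (0 < n)%N ->
  exists (T : ext_fld r -> Prop) s, [/\ subring T, subset (ext_dom r) T,
    size s = (r + n)%N, wchain (ext_dom r) T (fun x => x = 0) s (n.-1 - r)
    & admissible (ext_dom r) (ext_star r)
        (fun x => ext_dom r x /\ last (fun x => x = 0) s x)].
Proof.
move=> /(tilde_valE hD hq hs) [[[hV sDV] vV] adm] /krull_chainE [P [s0 [es hc]]] n0.
elim: r => [|r [T [s [hT sDT es' hw hadm]]]].
  case: s0 es hc => [|Q s] es [hP]; first by move: n0; rewrite -es.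
  move=> [[sPQ [x [Qx nPx]]] hc]; have hQ := pchain_prime hc.
  have vrV : valring V by [].
  (* The first prime [P] is replaced by (0); a nonzero prime [Q] of an overring meets [D]
     nontrivially. *)
  exists V, (Q :: s); rewrite add0n subn0; split=> //.
    split; first exact: prime_zero.
    split; first by move=> _ ->; exact: prime0 hQ.
    left; split; last by rewrite -es /=; exact: pchain_wchain.
    apply: contrapT => hno; apply: nPx.
    have -> : x = 0.
      apply: (prime_contr_zero hq _ hQ) Qx; first by split.
      move=> y Dy Qy; apply: contrapT => y0; apply: hno; by exists y.
    exact: prime0 hP.
  apply: admissible_sub adm.
    exact: prime_contr sDV (pchain_last hc).
  by move=> y [Dy ly]; split=> //; exact: prime_sub_maxid (pchain_last hc) _ ly.
have hDr := ext_subring r.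
have [y Ty hw'] := wchain_step hDr hT sDT (@ext_quotient_field r) hw.
exists (polyD T), (map (evp T y) ((fun x => x = 0) :: s)).
have hT' := polyD_subring hT.
have sDT' : subset (polyD (ext_dom r)) (polyD T).
  by move=> _ [p [hp ->]]; exists p; split=> // i; exact: sDT.
split=> //=.
- by rewrite size_map es'.
- by rewrite subnS.
apply/(admissible_polyD hDr (ext_unit_law r)); split.
  exact: prime_contr (polyD_subring hDr) sDT' (wchain_last hw').
have lastP := wchain_last hw.
rewrite last_map (_ : con _ _ = fun x => ext_dom r x /\ last (fun x => x = 0) s x) //.
apply/predeqP => a; rewrite /con; have hE := evp_const y a hT (prime_sub lastP).
split=> [[Da [_ /hE la]]|[Da la]] //.
by split=> //; split; [exact/polyD_const | exact/hE].
Qed.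

Lemma valuation_starn_chain V n r : tilde_val D star V -> krull_chain V n ->
  (0 < n)%N -> (n.-1 <= r)%N -> starn_chain r (r + n).
Proof.
move=> hV hn n0 hr; have [T [s [hT sDT es hw hadm]]] := wchain_ext r hV hn n0.
have hDr := ext_subring r.
(* By definition of [<=], [hr] says that the truncated difference is 0, so no invisible step is
   left. *)
rewrite (eqP hr) in hw; have := wchain_contr hDr sDT hw.
have -> : (fun x => ext_dom r x /\ x = 0) = (fun x => x = 0).
  by apply/predeqP => x; split=> [[]|->] //; split=> //; exact: subring0.
move=> hc; apply/starn_chainE; eexists; split; last 2 first.
- exact: hc.
- have -> : (fun x => x = 0) = (fun x => ext_dom r x /\ x = 0).
    by apply/predeqP => x; split=> [->|[]] //; split=> //; exact: subring0.
  by rewrite last_map.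
by rewrite size_map.
Qed.

(** A valuation ring over a chain in [T] has as its centre on [D] the contraction of the last prime,
    admissible by [linked_prime]. *)
Lemma linked_chain k : (exists T, linked D star T /\ krull_chain T k) <->
  exists V, tilde_val D star V /\ krull_chain V k.
Proof.
split=> [[T [hT /krull_chainE [P [s [es hc]]]]]|[V [hV hc]]]; last first.
  by exists V; split=> //; exact: tilde_val_linked.
have [[hTr sDT] _] := hT.
have [W [P' [s' [vW sTW es' hc' hl]]]] := val_chain hTr hc.
exists W; split; last by apply/krull_chainE; exists P', s'; rewrite es'.
apply/tilde_valE => //; split.
  by case: (vW) => hW vW'; split=> //; split=> // x /sDT /sTW.
rewrite (_ : center D W = fun x => D x /\ last P s x).
  exact: linked_prime (pchain_last hc).
apply/predeqP => x; split=> -[Dx h]; split=> //; first by apply/hl => //; exact: sDT.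
by apply/hl => //; exact: sDT.
Qed.

End Main.

Theorem theorem4p2 (K : fieldType) (D : K -> Prop)
    (star : (K -> Prop) -> (K -> Prop)) (n : nat) :
  subring D -> quotient_field_of D -> semistar D star -> (0 < n)%N ->
  (tilde_dimv_eq D star n <-> setting_dim_eq (starn D star n) (2 * n)) /\
  (tilde_dimv_eq D star n <->
     (forall r, (n.-1 <= r)%N -> setting_dim_eq (starn D star r) (r + n))) /\
  (tilde_dimv_eq D star n <->
     ((forall T, linked D star T -> krull_dim_le T n) /\
      (forall m, (m < n)%N -> ~ (forall T, linked D star T -> krull_dim_le T m)))).

Proof.
move=> hD hq hs n0.
pose dimv_ge k := exists V, tilde_val D star V /\ krull_chain V k.
have dimv_geW k m : (k <= m)%N -> dimv_ge m -> dimv_ge k.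
  by move=> hk [V [hV hc]]; exists V; split=> //; exact: krull_chain_le hc.
have lower k r : (0 < k)%N -> (k.-1 <= r)%N -> dimv_ge k ->
    star_chain (sdom (starn D star r)) (sop (starn D star r)) (r + k).
  by move=> k0 hk [V [hV hc]]; exact: (valuation_starn_chain hD hq hs hV hc).
have upper k r : star_chain (sdom (starn D star r)) (sop (starn D star r)) (r + k) ->
    dimv_ge k.
  move/(starn_chain_valuation hD hq hs) => [V [k' [hV hk hc]]].
  by apply: (dimv_geW _ k'); [lia | exists V].
have dimE : tilde_dimv_eq D star n <-> dimv_ge n /\ ~ dimv_ge n.+1.
  split=> -[h1 h2]; split=> //; first by move=> [V [hV hc]]; exact: h2 hV hc.
  by move=> V hV hc; apply: h2; exists V.
have dim_ext r : (n.-1 <= r)%N -> dimv_ge n /\ ~ dimv_ge n.+1 ->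
    setting_dim_eq (starn D star r) (r + n).
  move=> hr [h1 h2]; split; first exact: lower.
  by rewrite -addnS => /upper.
(* Excluding length [n.+1] through [lower] needs at least [n] variables, which is why [r = n] is
   used here. *)
have ext_dim : setting_dim_eq (starn D star n) (2 * n) -> dimv_ge n /\ ~ dimv_ge n.+1.
  rewrite mul2n -addnn => -[h1 h2]; split; first exact: upper h1.
  by move=> h; apply: h2; rewrite -addnS; exact: lower.
rewrite !dimE; split; last split.
- split=> // h; rewrite mul2n -addnn; apply: dim_ext => //; exact: leq_pred.
- split=> [h r hr|h]; first exact: dim_ext.
  by apply: ext_dim; rewrite mul2n -addnn; apply: h; exact: leq_pred.
split=> [[h1 h2]|[h1 h2]]; split.
- by move=> T hT hc; apply: h2; apply/(linked_chain hD hq hs); exists T.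
- move=> m hm h; have /(linked_chain hD hq hs) [T [hT hc]] := dimv_geW _ _ hm h1.
  exact: h hT hc.
(* Without a chain of length [n], the bound [n.-1] would already hold, against minimality. *)
- apply: contrapT => hn; apply: (h2 n.-1); first by rewrite prednK.
  move=> T hT; rewrite /krull_dim_le prednK // => hc; apply: hn.
  by apply/(linked_chain hD hq hs); exists T.
move=> /(linked_chain hD hq hs) [T [hT hc]]; exact: h1 hT hc.
Qed.
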